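(* Piecewise polynomial functions are finitely forcible. Specifically, if there is an interval partition $\{I_1,\dots,I_k\}$ of $[0,1]$, polynomials $P_1(x),\dots,P_k(x)$ of degrees $d_1,\dots,d_k$, respectively, and $f\in\mathcal{W}$ is such that $f(x)=P_i(x)$ for all $i\in\{1,\dots,k\}$ and $x\in I_i$, then there is a list of words $\boldsymbol{u}_1,\dots,\boldsymbol{u}_m$, with $m\le(k+1)^{2k^2(1+\max_i\deg P_i)}$, such that any Lebesgue measurable function $h:[0,1]\to[0,1]$ which satisfies $t(\boldsymbol{u}_i,h)=t(\boldsymbol{u}_i,f)$ for all $i\in\{1,\dots,m\}$ must agree with $f$ almost everywhere.
   Context: Words are finite sequences over $\{0,1\}$. $\mathcal{W}$ is the set of all Lebesgue measurable functions $f:[0,1]\to[0,1]$, identified when equal almost everywhere. An interval partition of $[0,1]$ is a partition of $[0,1]$ into finitely many intervals. For $f:[0,1]\to[0,1]$ measurable write $f^1=f$, $f^0=1-f$ and, for $\boldsymbol{u}\in\{0,1\}^\ell$, \[t(\boldsymbol{u},f)=\ell!\int_{0\le x_1<\dots<x_\ell\le1}\prod_{i=1}^{\ell}f^{u_i}(x_i)\,dx_1\cdots dx_\ell.\] A function $f\in\mathcal{W}$ is finitely forcible if there is a finite list of words $\boldsymbol{u}_1,\dots,\boldsymbol{u}_m$ such that any measurable $h:[0,1]\to[0,1]$ with $t(\boldsymbol{u}_i,h)=t(\boldsymbol{u}_i,f)$ for all $i\in\{1,\dots,m\}$ agrees with $f$ almost everywhere. *)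

(* Defs.v *)
From HB Require Import structures.
From mathcomp Require Import all_boot all_order all_algebra.
From mathcomp Require Import all_classical all_reals all_analysis.
From mathcomp Require Import measurable_realfun.

Set Implicit Arguments.
Unset Strict Implicit.
Unset Printing Implicit Defensive.

Import Order.TTheory GRing.Theory Num.Theory.
Import numFieldNormedType.Exports.

Local Open Scope classical_set_scope.
Local Open Scope ring_scope.

(* The real line with the sigma-algebra of Lebesgue measurable sets, i.e. the
   domain of [completed_lebesgue_measure] (the canonical structure on [R] itself
   is the Borel one). *)
Definition lebesgueR (R : realType) : measurableType _ :=
  caratheodory_type (R := R) (T := ocitv_type R) (@wlength R idfun)^*%mu.

Definition lebesgue1 (R : realType) :
    {sigma_finite_measure set (lebesgueR R) -> \bar R} :=
  @completed_lebesgue_measure R.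

Definition tuple_cons (T : Type) (n : nat) (p : T * n.-tuple T) : n.+1.-tuple T :=
  [tuple of p.1 :: p.2].

Lemma measurable_tuple_cons d (T : measurableType d) n :
  measurable_fun [set: T * n.-tuple T] (@tuple_cons T n).
Proof. exact: measurable_cons. Qed.

Definition cons_measure d (T : measurableType d) (R : realType)
    (mu : {sigma_finite_measure set T -> \bar R}) (n : nat)
    (nu : {sigma_finite_measure set (n.-tuple T) -> \bar R}) :
    set (n.+1.-tuple T) -> \bar R :=
  pushforward (mu \x nu)%E (@tuple_cons T n).

Section cons_measure_sigma_finite.
Context d (T : measurableType d) (R : realType).
Variables (mu : {sigma_finite_measure set T -> \bar R}) (n : nat).
Variable nu : {sigma_finite_measure set (n.-tuple T) -> \bar R}.
Local Open Scope ereal_scope.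

Let cons_measure0 : cons_measure mu nu set0 = 0.
Proof. by rewrite /cons_measure /pushforward preimage_set0 measure0. Qed.

Let cons_measure_ge0 A : 0 <= cons_measure mu nu A.
Proof. exact: (measure_ge0 (mu \x nu)). Qed.

Let cons_measure_semi_sigma_additive : semi_sigma_additive (cons_measure mu nu).
Proof.
have mcons := @measurable_tuple_cons _ T n.
move=> F mF tF mUF; rewrite /cons_measure /pushforward preimage_bigcup.
apply: measure_semi_sigma_additive.
- by move=> i; rewrite -[X in measurable X]setTI; exact: mcons.
- apply/trivIsetP => /= i j _ _ ij; rewrite -preimage_setI.
  by move/trivIsetP : tF => /(_ _ _ _ _ ij) ->//; rewrite preimage_set0.
- by rewrite -preimage_bigcup -[X in measurable X]setTI; exact: mcons.
Qed.

HB.instance Definition _ := isMeasure.Build _ _ _ (cons_measure mu nu)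
  cons_measure0 cons_measure_ge0 cons_measure_semi_sigma_additive.

Let cons_measure_sigma_finite : sigma_finite setT (cons_measure mu nu).
Proof.
have /sigma_finiteP[F [TF ndF Foo]] := sigma_finiteT mu.
have /sigma_finiteP[G [TG ndG Goo]] := sigma_finiteT nu.
pose g (t : n.+1.-tuple T) : T * n.-tuple T := (thead t, [tuple of behead t]).
have gK : cancel (@tuple_cons T n) g.
  by move=> [x t]; congr pair; apply/val_inj.
have mg : measurable_fun setT g.
  by apply: measurable_fun_pair; [exact: measurable_tnth|exact: measurable_behead].
exists (fun i => g @^-1` (F i `*` G i)).
  rewrite -preimage_bigcup -(preimage_setT g); congr (_ @^-1` _).
  rewrite -setXTT TF TG predeqE => -[x y]; split.
    move=> [/= [i _ Fx] [j _ Gy]]; exists (maxn i j) => //; split.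
    - by move: x Fx; exact/subsetPset/ndF/leq_maxl.
    - by move: y Gy; exact/subsetPset/ndG/leq_maxr.
  by move=> [i _ []/= ? ?]; split; exists i.
move=> i; have [mF Fi] := Foo i; have [mG Gi] := Goo i; split.
  by rewrite -[X in measurable X]setTI; apply: mg => //; exact: measurableX.
rewrite /cons_measure /pushforward -comp_preimage.
rewrite (_ : g \o _ = id); last by apply/funext => p /=; rewrite gK.
by rewrite preimage_id product_measure1E// lte_mul_pinfty// ge0_fin_numE.
Qed.

HB.instance Definition _ := Measure_isSigmaFinite.Build _ _ _
  (cons_measure mu nu) cons_measure_sigma_finite.

End cons_measure_sigma_finite.

Fixpoint tuple_measure d (T : measurableType d) (R : realType)
    (mu : {sigma_finite_measure set T -> \bar R}) (n : nat) :
    {sigma_finite_measure set (n.-tuple T) -> \bar R} :=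
  match n with
  | 0 => \d_([tuple] : 0.-tuple T)
  | n'.+1 => cons_measure mu (tuple_measure mu n')
  end.

Lemma tuple_measureE d (T : measurableType d) (R : realType)
    (mu : {sigma_finite_measure set T -> \bar R}) n (A : 'I_n -> set T) :
  (forall i, measurable (A i)) ->
  (tuple_measure mu n [set x | forall i, A i (tnth x i)] =
   \prod_(i < n) mu (A i))%E.
Proof.
elim: n A => [|n IH] A mA.
  by rewrite big_ord0 /= diracE mem_set//= => -[].
rewrite big_ord_recl /= -IH // /cons_measure /pushforward -product_measure1E //.
  congr ((_ \x _)%E _); apply/seteqP; split => -[x y] /=.
    move=> H; split; first exact: (H ord0).
    by move=> i; have := H (lift ord0 i); rewrite tnthS.
  move=> [Ax Ay] i; case: (unliftP ord0 i) => [j|] ->; last exact: Ax.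
  by rewrite tnthS; exact: Ay.
have -> : [set x : n.-tuple T | forall i, A (lift ord0 i) (tnth x i)] =
    \bigcap_(i in [set: 'I_n]) ((fun x => tnth x i) @^-1` A (lift ord0 i)).
  by apply/seteqP; split => x /= H i; [move=> _|]; exact: H.
apply: fin_bigcap_measurable; first exact: finite_finset.
by move=> i _; rewrite -[X in measurable X]setTI; exact: measurable_tnth.
Qed.

(* The sigma-algebra on tuples is the product of the one-dimensional Lebesgue
   sigma-algebras, not its completion; the integrand of [word_density] is
   measurable for it when [in_W f] holds, so the integral is the usual one. *)
Definition lebesgue_tuple (R : realType) (n : nat) :
    {sigma_finite_measure set (n.-tuple (lebesgueR R)) -> \bar R} :=
  tuple_measure (lebesgue1 R) n.

(* Functions on [0, 1] are represented by total functions on [R] whose values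
   outside [0, 1] are irrelevant; the identification of functions that are equal
   almost everywhere is made explicit by [ae_eq01]. *)
Definition in_W (R : realType) (f : R -> R) : Prop :=
  measurable_fun (`[0, 1]%classic : set (lebesgueR R)) (f : lebesgueR R -> R) /\
  set_fun `[0, 1]%classic `[0, 1]%classic f.

Definition ae_eq01 (R : realType) (f g : R -> R) : Prop :=
  {ae lebesgue1 R, forall x : R, x \in `[0, 1] -> f x = g x}.

Definition ordered_simplex (R : realType) (n : nat) :
    set (n.-tuple (lebesgueR R)) :=
  [set x | (forall i, (tnth x i : R) \in `[0, 1]) /\
           (forall i j : 'I_n, (i < j)%N -> (tnth x i : R) < tnth x j)].

Definition letter_fun (R : realType) (f : R -> R) (b : bool) (x : R) : R :=
  if b then f x else 1 - f x.

Definition word_density (R : realType) (u : seq bool) (f : R -> R) : R :=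
  (size u)`!%:R *
  \int[lebesgue_tuple R (size u)]_(x in @ordered_simplex R (size u))
    \prod_(i < size u) letter_fun f (tnth (in_tuple u) i) (tnth x i).

Definition forced_by (R : realType) (us : seq (seq bool)) (f : R -> R) : Prop :=
  forall h : R -> R, in_W h ->
    (forall u, u \in us -> word_density u h = word_density u f) ->
    ae_eq01 h f.

Definition finitely_forcible (R : realType) (f : R -> R) : Prop :=
  exists us : seq (seq bool), forced_by us f.

Definition interval_partition (R : realType) (k : nat) (I : 'I_k -> set R) : Prop :=
  (forall i, is_interval (I i)) /\ partition [set: 'I_k] I `[0, 1]%classic.

(* The zero polynomial has degree 0. *)
Definition degree (R : realType) (p : {poly R}) : nat := (size p).-1.

(* Main.v *)
Require Import Defs.
From mathcomp Require Import all_boot all_order all_algebra.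
From mathcomp Require Import all_classical all_reals all_analysis.
From mathcomp Require Import measurable_realfun.
From mathcomp Require Import ring lra zify.

Set Implicit Arguments.
Unset Strict Implicit.
Unset Printing Implicit Defensive.

Import Order.TTheory GRing.Theory Num.Theory.
Import numFieldNormedType.Exports.

Local Open Scope classical_set_scope.
Local Open Scope ring_scope.

(** Write [H x] for the integral of [h] over [x, 1] ([ones h] below) and
    [z = 1 - x]. The theorem is proved by showing that [H] is forced; [h] is then
    recovered almost everywhere, since the tail integrals of a density determine
    it ([tail_inj]).

    Word densities see polynomials in [z] and [H]. The density of a word is an
    iterated tail integral ([word_densityE]), and the product rule
    ([tail_mul]) expands a monomial [z ^+ a * H ^+ b] as a combination of iterated
    integrals of words of length [a + b], with coefficients independent of [h]
    ([monomial_words]). After one integration by parts, the integral of [B(z, H)]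
    over the unit interval is determined, for each polynomial [B], by the
    densities of finitely many words, all starting with the letter [1]
    ([agree_poly_integral]).

    When [f] is piecewise polynomial, its tail integral [F] coincides on each
    piece with a polynomial [Phi i] in [z] ([ones_piecewise]). The squared
    separator [A = \prod_i (H - Phi i (z)) ^+ 2] is nonnegative and its integral
    is [0] for [F]. If [h] has the same word densities, its integral is [0] for [H]
    too, so at each point [H] takes the value of one of the [Phi i]
    ([ones_in_pieces]). With one piece this gives [H = F].

    With several pieces [H] could still leave [F] where two of the [Phi i] cross.
    But [H - F] can then change sign only at these finitely many crossings
    ([no_sign_change]), so there is a polynomial [p] in [z] such that
    [p * (H - F)] is nonnegative ([sign_matching_poly]). The integral of
    [p * (H - F)] is a combination of moments on which [H] and [F] agree, so it is
    [0], and [H = F] ([ones_eq_of_moments]).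

    The number of words used is below [2 ^ (3 d k ^ 2)], where [d] is one more than
    the largest degree, because [H - F] has at most [d k ^ 2] crossings; this is
    within the bound for [1 < k]. For [k = 1] the bound is [4 ^ d], which is
    attained for [d = 1], so the choice of words must be tight: their first letter
    is [1], and the monomials of the squared separator that involve [H] have total
    degree from [2] to [d + 1], because [Phi] has no constant term. *)

(** * Tail integrals against Lebesgue measure *)

Section tail.
Context (R : realType).
Local Notation T := (lebesgueR R).
Local Notation mu := (lebesgue1 R).

Lemma measurable_borel_lebesgue (A : set R) :
  measurable A -> measurable (A : set T).
Proof.
move=> mA.
exact: (@sub_caratheodory _ _ _ (@wlength R idfun)).
Qed.

Lemma measurable_lebesgueR_id : measurable_fun [set: T] (fun x : T => x : R).
Proof. by move=> _ B mB; rewrite setTI; exact: measurable_borel_lebesgue. Qed.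

Definition unit_ind : T -> R := \1_(`[0, 1]%classic : set R).

Lemma unit_indE (x : R) : unit_ind x = (0 <= x <= 1)%R%:R.
Proof. by rewrite /unit_ind indicE mem_setE in_itv. Qed.

(** Bounded measurable functions that vanish off the unit interval: every such
    function is integrable, and its tail integral is defined and continuous on
    the whole line. *)
Definition density (phi : T -> R) :=
  measurable_fun [set: T] phi /\ exists M, forall x, `|phi x| <= M * unit_ind x.

Lemma measurable_unit_ind : measurable_fun [set: T] unit_ind.
Proof. by apply: measurable_indic; exact: measurable_borel_lebesgue. Qed.

Lemma integrable_density phi (D : set T) : density phi -> measurable D ->
  mu.-integrable D (EFin \o phi).
Proof.
move=> [mphi [M phiM]] mD; apply: (integrableS measurableT) => //.
have m01 : measurable (`[0, 1]%classic : set T).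
  exact: measurable_borel_lebesgue.
have -> : EFin \o phi = (EFin \o phi) \_ (`[0, 1]%classic : set T).
  apply/funext => x; rewrite patchE; case: ifPn => // xN /=.
  have := phiM x; rewrite unit_indE; move: xN; rewrite mem_setE in_itv/= => /negbTE->.
  by rewrite mulr0 normr_le0 => /eqP->.
apply/(integrable_mkcond _ m01); apply: measurable_bounded_integrable => //.
- rewrite [X in (X < _)%E](_ : _ = lebesgue_measure (`[0, 1]%classic : set R))//.
  by rewrite lebesgue_measure_itv /= lte01 oppr0 adde0 ltry.
- exact: measurable_funTS.
- exists `|M|; split; first exact: num_real.
  move=> y My x _ /=; rewrite (le_trans (phiM x))// (le_trans _ (ltW My))//.
  rewrite (le_trans (ler_norm _))// normrM unit_indE normr_nat.
  by rewrite ler_piMr// lern1; case: (_ <= _ <= _).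
Qed.

(** Minus the primitive of [phi] that vanishes at [+oo]. Integrating from the right
    matches words read from left to right: once the first letter sits at [y],
    the other letters live in [`]y, +oo[]. *)
Definition tail (phi : T -> R) (y : R) : R :=
  \int[mu]_(x in (`]y, +oo[%classic : set T)) phi x.

Lemma measurable_ray (y : R) : measurable (`]y, +oo[%classic : set T).
Proof. exact: measurable_borel_lebesgue. Qed.

Lemma tailB_itv phi x y : density phi -> x <= y ->
  tail phi x - tail phi y = \int[mu]_(t in (`]x, y]%classic : set T)) phi t.
Proof.
move=> dphi xy; rewrite /tail.
have -> : `]x, +oo[%classic = `]x, y]%classic `|` `]y, +oo[%classic.
  by rewrite -itv_bndbnd_setU.
rewrite Rintegral_setU ?addrK//.
- exact: measurable_borel_lebesgue.
- exact: measurable_ray.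
- apply: integrable_density => //.
  by apply: measurableU; exact: measurable_borel_lebesgue.
- apply/disj_setPS => z [/=]; rewrite 2!in_itv/= => /andP[_ zy] /andP[].
  by rewrite ltNge zy.
Qed.

Lemma tail_lipschitz phi : density phi ->
  exists M, forall x y, `|tail phi x - tail phi y| <= M * `|x - y|.
Proof.
move=> dphi; have [mphi [M phiM]] := dphi.
have M0 : 0 <= M.
  have := phiM 0; rewrite unit_indE lexx ler01 mulr1; exact: le_trans.
suff H x y : x <= y -> `|tail phi x - tail phi y| <= M * `|x - y|.
  exists M => x y; have [|/ltW] := leP x y; first exact: H.
  by move=> /H; rewrite distrC [X in _ * X]distrC.
move=> xy; rewrite tailB_itv//.
have mxy : measurable (`]x, y]%classic : set T) by exact: measurable_borel_lebesgue.
apply: (le_trans (le_normr_Rintegral mxy _)); first exact: integrable_density.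
have -> : M * `|x - y| = \int[mu]_(t in (`]x, y]%classic : set T)) M.
  rewrite Rintegral_cst//.
  rewrite [X in _ = _ * fine X](_ : _ = lebesgue_measure (`]x, y]%classic : set R))//.
  rewrite lebesgue_measure_itv/= lte_fin.
  have [xy'|yx] := ltP x y; first by rewrite distrC ger0_norm// subr_ge0.
  by have -> : x = y; [apply/le_anti/andP|rewrite subrr normr0].
apply: le_Rintegral => //.
- exact/integrable_norm/integrable_density.
- apply: measurable_bounded_integrable => //.
    rewrite [X in (X < _)%E](_ : _ = lebesgue_measure (`]x, y]%classic : set R))//.
    by rewrite lebesgue_measure_itv/=; case: ifP => _; exact: ltry.
  exists M; split; first exact: num_real.
  by move=> z Mz t _ /=; rewrite ger0_norm// ltW.
- move=> t _; rewrite (le_trans (phiM t))// ler_piMr// unit_indE.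
  by rewrite lern1; case: (_ <= _ <= _).
Qed.

Lemma continuous_tail phi : density phi -> continuous (tail phi).
Proof.
move=> /tail_lipschitz[M lipM] x.
have M1 : 0 < `|M| + 1 by rewrite ltr_wpDl.
apply/cvgrPdist_lt => e e0; near=> y.
rewrite (le_lt_trans (lipM _ _))//.
have : `|x - y| < e / (`|M| + 1).
  by near: y; exists (e / (`|M| + 1)) => //=; rewrite divr_gt0.
rewrite ltr_pdivlMr// mulrC; apply: le_lt_trans.
by rewrite ler_wpM2r// (le_trans (ler_norm _))// lerDl.
Unshelve. all: by end_near. Qed.

Lemma tail_ge0 phi y : (forall x, 0 <= phi x) -> 0 <= tail phi y.
Proof. by move=> phi0; apply: Rintegral_ge0. Qed.

Lemma density_eq0 phi (x : R) : density phi -> ~~ (0 <= x <= 1) -> phi x = 0.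
Proof.
move=> [_ [M /(_ x)]]; rewrite unit_indE => + /negbTE x01.
by rewrite x01 mulr0 normr_le0 => /eqP.
Qed.

Lemma tail_ge1 phi (y : R) : density phi -> 1 <= y -> tail phi y = 0.
Proof.
move=> dphi y1; rewrite /tail (@eq_Rintegral _ _ _ _ _ (fun=> 0)).
  by rewrite Rintegral_cst ?mul0r//; exact: measurable_ray.
move=> x; rewrite mem_setE in_itv/= andbT => yx; apply: density_eq0 => //.
by rewrite negb_and -(ltNge 1 x) (le_lt_trans y1 yx) orbT.
Qed.

Lemma Rintegral_setD1 phi (D : set T) (c : R) : density phi -> measurable D ->
  \int[mu]_(t in D) phi t = \int[mu]_(t in D `\ (c : T)) phi t.
Proof.
move=> dphi mD; congr fine; apply: negligible_integral => //.
- exact: measurable_borel_lebesgue.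
- exact: integrable_density.
- exact: lebesgue_measure_set1.
Qed.

Lemma tail_le0 phi (y : R) : density phi -> y <= 0 -> tail phi y = tail phi 0.
Proof.
move=> dphi y0; apply/eqP; rewrite -subr_eq0 tailB_itv// (@Rintegral_setD1 _ _ 0)//.
  rewrite (@eq_Rintegral _ _ _ _ _ (fun=> 0)).
    rewrite Rintegral_cst ?mul0r//; apply: measurableD;
    exact: measurable_borel_lebesgue.
  move=> x; rewrite inE /= in_itv/= => -[/andP[_ x0] /eqP xN0].
  apply: density_eq0 => //; rewrite negb_and -ltNge lt_neqAle.
  by rewrite (_ : (x : R) != 0 :> R)// x0.
exact: measurable_borel_lebesgue.
Qed.

Lemma density_unit_ind : density unit_ind.
Proof.
split; first exact: measurable_unit_ind.
by exists 1 => x; rewrite mul1r unit_indE normr_nat.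
Qed.

(** The only source of products of densities below: the factor [g] is always
    built from tail integrals, hence continuous, hence bounded on [`[0, 1]]. *)
Lemma densityMr phi (g : R -> R) : density phi -> continuous g ->
  density (fun x : T => phi x * g x).
Proof.
move=> [mphi [M phiM]] cg; split.
  apply: measurable_funM => //; apply: (measurableT_comp _ measurable_lebesgueR_id).
  exact: continuous_measurable_fun.
have cng : {within `[0 : R, 1], continuous (fun x => `|g x|)}.
  apply: continuous_subspaceT => x.
  by apply: continuous_comp; [exact: cg|exact: norm_continuous].
have [c _ gc] := EVT_max ler01 cng.
exists (M * `|g c|) => x; rewrite normrM.
have := phiM x; rewrite unit_indE; case: (boolP (0 <= (x : R) <= 1)) => [x01|_].
  rewrite !mulr1 => phixM; apply: ler_pM => //.
  by apply: gc; rewrite in_itv.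
by rewrite mulr0 normr_le0 => /eqP->; rewrite normr0 mul0r mulr0.
Qed.

Lemma densityZ (c : R) phi : density phi -> density (fun x : T => c * phi x).
Proof.
move=> dphi; under eq_fun do rewrite mulrC.
by apply: (densityMr (g := fun=> c)) => // x; exact: cst_continuous.
Qed.

Lemma densityD phi psi : density phi -> density psi ->
  density (fun x : T => phi x + psi x).
Proof.
move=> [mphi [M phiM]] [mpsi [N psiN]]; split; first exact: measurable_funD.
exists (M + N) => x; rewrite (le_trans (ler_normD _ _))// mulrDl lerD//.
Qed.

Lemma density0 : density (fun=> 0).
Proof. by split; [exact: measurable_cst|exists 0 => x; rewrite normr0 mul0r]. Qed.

Lemma density_sum (I : Type) (s : seq I) (phi : I -> T -> R) :
  (forall i, density (phi i)) -> density (fun x : T => \sum_(i <- s) phi i x).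
Proof.
move=> dphi; elim: s => [|i s IH].
  by under eq_fun do rewrite big_nil; exact: density0.
by under eq_fun do rewrite big_cons; exact: densityD.
Qed.

Lemma tailZ (c : R) phi y : density phi ->
  tail (fun x => c * phi x) y = c * tail phi y.
Proof.
move=> dphi; apply: RintegralZl; first exact: measurable_ray.
by apply: integrable_density => //; exact: measurable_ray.
Qed.

Lemma tailD phi psi y : density phi -> density psi ->
  tail (fun x => phi x + psi x) y = tail phi y + tail psi y.
Proof.
move=> dphi dpsi; apply: RintegralD; first exact: measurable_ray.
  by apply: integrable_density => //; exact: measurable_ray.
by apply: integrable_density => //; exact: measurable_ray.
Qed.

Lemma tail_sum (I : Type) (s : seq I) (phi : I -> T -> R) y :
  (forall i, density (phi i)) ->
  tail (fun x => \sum_(i <- s) phi i x) y = \sum_(i <- s) tail (phi i) y.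
Proof.
move=> dphi; elim: s => [|i s IH].
  rewrite big_nil /tail (@eq_Rintegral _ _ _ _ _ (fun=> 0)).
    by rewrite Rintegral_cst ?mul0r//; exact: measurable_ray.
  by move=> x _; rewrite big_nil.
rewrite big_cons -IH -(tailD y (dphi i) (density_sum s dphi)).
by apply: eq_Rintegral => x _; rewrite big_cons.
Qed.

(** Moving the ray into the integrand puts the integral in the form that Tonelli
    needs. *)
Lemma EFin_tail phi y : density phi ->
  (tail phi y)%:E = (\int[mu]_x ((phi x * (y < x)%R%:R)%:E))%E.
Proof.
move=> dphi; rewrite /tail /Rintegral fineK; last first.
  apply: integrable_fin_num; first exact: measurable_ray.
  by apply: integrable_density => //; exact: measurable_ray.
rewrite integral_mkcond; apply: eq_integral => x _.
rewrite patchE mem_setE in_itv/= andbT.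
by case: ifP => yx; rewrite ?yx (mulr1, mulr0).
Qed.

Lemma measurable_ltR (y : R) : measurable_fun [set: T] (fun x : T => ((y < x)%R%:R : R)).
Proof.
rewrite (_ : (fun _ => _) = \1_(`]y, +oo[%classic : set T)).
  by apply: measurable_indic; exact: measurable_ray.
by apply/funext => x; rewrite indicE mem_setE in_itv/= andbT.
Qed.

End tail.

(** * The product rule for tail integrals *)

Section product_rule.
Context (R : realType).
Local Notation T := (lebesgueR R).
Local Notation mu := (lebesgue1 R).
Implicit Types phi psi : T -> R.

Lemma tail_between phi (y s : R) : density phi -> y < s ->
  (\int[mu]_t ((phi t * ((y < t)%R%:R * (t < s)%R%:R))%:E))%E =
  (tail phi y - tail phi s)%:E.
Proof.
move=> dphi ys; rewrite tailB_itv ?(ltW ys)//.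
have mys : measurable (`]y, s]%classic : set T) by exact: measurable_borel_lebesgue.
rewrite (@Rintegral_setD1 _ _ _ s)// /Rintegral fineK; last first.
  apply: integrable_fin_num; last apply: integrable_density => //.
    by apply: measurableD => //; exact: measurable_borel_lebesgue.
  by apply: measurableD => //; exact: measurable_borel_lebesgue.
rewrite [RHS]integral_mkcond; apply: eq_integral => x _.
rewrite patchE; case: ifPn; rewrite ?notin_setE ?inE/= in_itv/=.
  by move=> [/andP[-> xs] /eqP xNs]; rewrite lt_neqAle xs [X in X && _]xNs !mulr1.
move=> xN; have [yx|] := ltP y x; last by rewrite !(mul0r, mulr0).
have [xs|] := ltP (x : R) s; last by rewrite !mulr0.
exfalso; apply: xN; rewrite yx (ltW xs); split => // xsE.
by rewrite xsE ltxx in xs.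
Qed.

Lemma measurable_gtR (s : R) :
  measurable_fun [set: T] (fun t : T => ((t < s)%R%:R : R)).
Proof.
rewrite (_ : (fun _ => _) = \1_(`]-oo, s[%classic : set T)).
  by apply: measurable_indic; exact: measurable_borel_lebesgue.
by apply/funext => x; rewrite indicE mem_setE in_itv.
Qed.

(** Tonelli on the triangle [y < t < s]: on the left [s] is integrated first, on
    the right [t] is. *)
Lemma tail_swap phi psi y : density phi -> density psi ->
  (forall x, 0 <= phi x) -> (forall x, 0 <= psi x) ->
  tail (fun t : T => psi t * tail phi t) y =
  tail (fun s : T => phi s * (tail psi y - tail psi s)) y.
Proof.
move=> dphi dpsi phi0 psi0; apply: EFin_inj.
have mphi := dphi.1; have mpsi := dpsi.1.
rewrite EFin_tail; last by apply: densityMr => //; exact: continuous_tail.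
rewrite EFin_tail; last first.
  apply: densityMr => //.
  by move=> x; apply: cvgB; [exact: cst_continuous|exact: continuous_tail].
(* p.1 is the variable t of the outer integral on the left, p.2 is s. *)
pose k (p : T * T) : \bar R :=
  ((psi p.1 * (y < p.1)%R%:R * (phi p.2 * (p.1 < p.2)%R%:R))%:E)%E.
have mk : measurable_fun setT k.
  apply/measurable_EFinP; apply: measurable_funM; apply: measurable_funM.
  - exact: (measurableT_comp mpsi measurable_fst).
  - exact: (measurableT_comp (measurable_ltR y) measurable_fst).
  - exact: (measurableT_comp mphi measurable_snd).
  - apply: (@measurableT_comp _ _ _ _ _ _ (fun b : bool => (b%:R : R))) => //.
    apply: measurable_fun_ltr.
      exact: (measurableT_comp (@measurable_lebesgueR_id R) measurable_fst).
    exact: (measurableT_comp (@measurable_lebesgueR_id R) measurable_snd).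
have mphi_lt t : measurable_fun [set: T] (fun s : T => (phi s * (t < s)%R%:R)%:E).
  by apply/measurable_EFinP; exact: (measurable_funM mphi (measurable_ltR t)).
have mpsi_bt s : measurable_fun [set: T]
    (fun t : T => (psi t * ((y < t)%R%:R * (t < s)%R%:R))%:E).
  apply/measurable_EFinP; apply: (measurable_funM mpsi).
  exact: (measurable_funM (measurable_ltR y) (measurable_gtR s)).
have k0 p : (0 <= k p)%E by rewrite lee_fin !mulr_ge0.
transitivity (\int[mu]_t \int[mu]_s k (t, s))%E.
  apply: eq_integral => t _.
  rewrite /k/= mulrAC EFinM (EFin_tail _ dphi) -ge0_integralZl; last 4 first.
  - exact: measurableT.
  - exact: mphi_lt.
  - by move=> x _; rewrite lee_fin mulr_ge0.
  - by rewrite lee_fin mulr_ge0.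
  by [].
rewrite (fubini_tonelli k)//.
apply: eq_integral => s _.
have [ys|sy] := ltP y s; last first.
  rewrite mulr0 integral0_eq// => t _; rewrite /k /=.
  case: (ltP y t) => yt; last by rewrite mulr0 mul0r.
  by rewrite (le_gtF (le_trans sy (ltW yt))) !mulr0.
rewrite mulr1 EFinM -(tail_between dpsi ys) -ge0_integralZl; last 4 first.
- exact: measurableT.
- exact: mpsi_bt.
- by move=> x _; rewrite lee_fin !mulr_ge0.
- by rewrite lee_fin.
by apply: eq_integral => t _; rewrite /k/= -EFinM; congr (_%:E); ring.
Qed.

(** Integration by parts. The densities are only measurable, so there is no
    pointwise derivative to appeal to; splitting the square [(s, t)] along its
    diagonal replaces it. *)
Lemma tail_mul phi psi y : density phi -> density psi ->
  (forall x, 0 <= phi x) -> (forall x, 0 <= psi x) ->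
  tail phi y * tail psi y =
  tail (fun x : T => phi x * tail psi x + psi x * tail phi x) y.
Proof.
move=> dphi dpsi phi0 psi0.
have cphi := continuous_tail dphi; have cpsi := continuous_tail dpsi.
have dB : density (fun s : T => phi s * (tail psi y - tail psi s)).
  by apply: densityMr => // x; apply: cvgB; [exact: cst_continuous|exact: cpsi].
rewrite tailD; [|exact: densityMr|exact: densityMr].
have dM : density (fun s : T => phi s * tail psi s) by exact: densityMr.
rewrite (tail_swap y dphi dpsi phi0 psi0) -(tailD y dM dB).
rewrite mulrC -tailZ//; apply: eq_Rintegral => x _.
by rewrite -mulrDr addrC subrK mulrC.
Qed.

Lemma tail_unit_ind (y : R) : 0 <= y <= 1 -> tail (@unit_ind R) y = 1 - y.
Proof.
move=> /andP[y0 y1].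
have du := @density_unit_ind R.
rewrite -[LHS]subr0 -(tail_ge1 du (lexx 1)) (tailB_itv du y1).
rewrite (@eq_Rintegral _ _ _ _ _ (fun=> 1)).
  rewrite Rintegral_cst; last exact: measurable_borel_lebesgue.
  rewrite [X in _ * fine X](_ : _ = lebesgue_measure (`]y, 1]%classic : set R))//.
  rewrite lebesgue_measure_itv/= lte_fin mul1r.
  have [//|y1'] := ltP y 1.
  by have -> : y = 1; [apply/le_anti/andP|rewrite subrr].
move=> x; rewrite mem_setE in_itv/= => /andP[yx x1].
by rewrite unit_indE x1 (le_trans y0 (ltW yx)).
Qed.

Lemma tail_nonincreasing phi x y : density phi -> (forall x, 0 <= phi x) ->
  x <= y -> tail phi y <= tail phi x.
Proof.
by move=> dphi phi0 xy; rewrite -subr_ge0 tailB_itv//; apply: Rintegral_ge0.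
Qed.

Lemma tail_ge phi (c y a b : R) : density phi -> (forall x, 0 <= phi x) ->
  y <= a <= b -> (forall x, a < x <= b -> c <= phi x) ->
  c * (b - a) <= tail phi y.
Proof.
move=> dphi phi0 /andP[ya ab] cphi.
apply: (le_trans _ (tail_nonincreasing dphi phi0 ya)).
rewrite -(subrK (tail phi b) (tail phi a)) ler_wpDr ?tail_ge0// tailB_itv//.
have mab : measurable (`]a, b]%classic : set T) by exact: measurable_borel_lebesgue.
have muab : mu `]a, b]%classic = (b - a)%:E.
  rewrite [LHS](_ : _ = lebesgue_measure (`]a, b]%classic : set R))//.
  rewrite lebesgue_measure_itv/= lte_fin; have [//|ba] := ltP a b.
  by have -> : a = b; [apply/le_anti/andP|rewrite subrr].
have -> : c * (b - a) = \int[mu]_(x in (`]a, b]%classic : set T)) c.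
  by rewrite Rintegral_cst// [X in fine X](muab).
apply: le_Rintegral => //.
- apply: measurable_bounded_integrable => //.
    by rewrite [X in (X < _)%E](muab) ltry.
  exists `|c|; split; first exact: num_real.
  by move=> z Mz t _ /=; rewrite ltW.
- exact: integrable_density.
Qed.

(** A continuous nonnegative function with zero integral vanishes everywhere, not
    just almost everywhere. This turns the vanishing of the integrals of the
    squared separator and of the sign-matched difference into pointwise
    identities. *)
Lemma tail_eq0 (g : R -> R) : continuous g ->
  (forall x, 0 <= x <= 1 -> 0 <= g x) ->
  tail (fun x : T => unit_ind x * g x) 0 = 0 ->
  forall x, 0 <= x <= 1 -> g x = 0.
Proof.
move=> cg g0 tg0 c c01; apply/eqP/contraT => gc.
have {gc}gc0 : 0 < g c by rewrite lt_neqAle eq_sym gc g0.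
have dg : density (fun x : T => unit_ind x * g x).
  by apply: densityMr; [exact: density_unit_ind|exact: cg].
have ug0 (x : T) : 0 <= unit_ind x * g x.
  rewrite unit_indE; case: (boolP (0 <= (x : R) <= 1)) => [/g0|_].
    by rewrite mul1r.
  by rewrite mul0r.
have /cvgrPdist_lt/(_ (g c / 2)) := cg c.
have gc20 : 0 < g c / 2 by rewrite divr_gt0.
move=> /(_ gc20)[e /= e0 eg].
(* A nondegenerate interval inside [0, 1], near c, on which g >= g c / 2. *)
pose a := Num.max 0 (c - e / 2); pose b := Num.min 1 (c + e / 2).
have [c0 c1] := andP c01.
have ab : a < b.
  by rewrite /a /b gt_max !lt_min -!andbA; apply/and4P; split; lra.
have a0 : 0 <= a by rewrite le_max lexx.
have b1 : b <= 1 by rewrite ge_min lexx.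
have gab (x : R) : a < x <= b -> g c / 2 <= unit_ind x * g x.
  rewrite gt_max le_min => /andP[/andP[x0 cx] /andP[x1 xc]].
  rewrite unit_indE x1 (ltW x0) mul1r.
  have := eg x; rewrite /ball_/=.
  have -> : `|c - x| < e by rewrite ltr_norml; lra.
  move=> /(_ isT); rewrite ltr_norml; lra.
have := @tail_ge _ (g c / 2) 0 a b dg ug0; rewrite a0 (ltW ab) tg0.
move=> /(_ isT gab); rewrite leNgt mulr_gt0// subr_gt0//.
Qed.

End product_rule.

(** * A density is determined by its tail integrals *)

Section tail_inj.
Context (R : realType).
Local Notation T := (lebesgueR R).
Local Notation mu := (lebesgue1 R).
Implicit Types phi psi : T -> R.

(** The rays [`]y, +oo[] are stable by intersection and generate the Borel sets,
    so two finite measures that agree on them agree on all Borel sets. *)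
Lemma integral_borel_eq phi psi : density phi -> density psi ->
  (forall x, 0 <= phi x) -> (forall x, 0 <= psi x) ->
  tail phi =1 tail psi ->
  forall A : set R, measurable A ->
  (\int[mu]_(x in (A : set T)) (phi x)%:E = \int[mu]_(x in (A : set T)) (psi x)%:E)%E.
Proof.
move=> dphi dpsi phi0 psi0 eqt A mA.
have mGA : (@RGenOInfty.G R).-sigma.-measurable A.
  by rewrite -RGenOInfty.measurableE; exact: mA.
have iphi := integrable_density dphi measurableT.
have ipsi := integrable_density dpsi measurableT.
have nuphi (E : set T) : (0 <= induced_charge iphi E)%E.
  by apply: integral_ge0 => x _; rewrite lee_fin.
have nupsi (E : set T) : (0 <= induced_charge ipsi E)%E.
  by apply: integral_ge0 => x _; rewrite lee_fin.
pose G : set (set T) := @RGenOInfty.G R.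
apply: (@g_sigma_algebra_measure_unique _ R T G _
  (fun n : nat => `](- n%:R)%R, +oo[%classic : set T) _ _
  (measure_of_charge _ nuphi) (measure_of_charge _ nupsi)) => //.
- by move=> _ [x ->]; exact: measurable_ray.
- by move=> n; exists (- n%:R).
- apply/seteqP; split => // x _.
  exists (Num.truncn `|x : R|).+1 => //=; rewrite in_itv/= andbT ltrNl.
  by rewrite (le_lt_trans (ler_norm _))// normrN truncnS_gt.
- move=> _ _ [x ->] [y ->]; exists (Num.max x y).
  by rewrite predeqE => z; split; rewrite /= !in_itv/= !andbT ?gt_max;
     [move=> [-> ->]|move=> /andP].
- move=> _ [x ->]; have := congr1 (@EFin R) (eqt x).
  rewrite /tail /Rintegral !fineK//; apply: integrable_fin_num => //;
    try exact: measurable_ray;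
    by apply: integrable_density => //; exact: measurable_ray.
- move=> n; rewrite ltey_eq /measure_of_charge; apply/orP; left.
  by apply: fin_num_measure; exact: measurable_ray.
Qed.

(** A Lebesgue measurable set is a Borel set up to a null set, so the previous
    lemma extends to it. *)
Lemma tail_inj phi psi : density phi -> density psi ->
  (forall x, 0 <= phi x) -> (forall x, 0 <= psi x) ->
  tail phi =1 tail psi -> {ae mu, forall x, phi x = psi x}.
Proof.
move=> dphi dpsi phi0 psi0 eqt.
have iphi := integrable_density dphi measurableT.
have ipsi := integrable_density dpsi measurableT.
suff : ae_eq mu setT (EFin \o phi) (EFin \o psi).
  by apply: filterS => x /(_ I) [].
apply: (integral_ae_eq measurableT iphi); first exact/measurable_EFinP/(dpsi.1).
move=> E _ mE.
have : (completed_algebra_gen (@lebesgue_measure R)) E.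
  rewrite -g_sigma_completed_algebra_genE completed_caratheodory_measurable.
  exact: mE.
move=> [B mB [N [N' [mN' N'0 NN']] BNE]].
have mB' := measurable_borel_lebesgue mB.
have mN'' := measurable_borel_lebesgue mN'.
(* E and the Borel set B \ N' differ by a null set. *)
have drop (chi : T -> R) : density chi ->
  (\int[mu]_(x in E) (EFin \o chi) x = \int[mu]_(x in ((B `\` N') : set T)) (chi x)%:E)%E.
  move=> dchi; rewrite (@negligible_integral _ _ _ _ E N')//; last first.
    exact: integrable_density.
  congr (integral _ _ _); rewrite -BNE; apply/seteqP; split => x /=.
    by move=> [[Bx|/NN']].
  by move=> [Bx N'x]; split => //; left.
rewrite !drop//; apply: integral_borel_eq => //; exact: measurableD.
Qed.

End tail_inj.

(** * Word densities as iterated tail integrals *)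

Section words.
Context (R : realType).
Local Notation T := (lebesgueR R).
Local Notation mu := (lebesgue1 R).
Implicit Types (h : R -> R) (u : seq bool) (y : R).

Definition letter_density h (b : bool) (x : T) : R := unit_ind x * letter_fun h b x.

(** [word_tail h u y] is the integral of the letters of [u] over
    [y < x_1 < ... < x_n <= 1]. *)
Fixpoint word_tail h u : R -> R :=
  if u is b :: u' then tail (fun x : T => letter_density h b x * word_tail h u' x)
  else fun=> 1.

Lemma letter_density_ge0 h b x : in_W h -> 0 <= letter_density h b x.
Proof.
move=> [_ h01]; rewrite /letter_density unit_indE.
have [x01|_] := boolP (0 <= (x : R) <= 1); last by rewrite mul0r.
have : `[0, 1]%classic (h x) by apply: h01; rewrite /= in_itv.
by rewrite /= in_itv /= mul1r /letter_fun => /andP[hx0 hx1]; case: b; rewrite ?subr_ge0.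
Qed.

Lemma density_letter h b : in_W h -> density (letter_density h b).
Proof.
move=> Wh; have [mh h01] := Wh.
have m01 : measurable (`[0, 1]%classic : set T) by exact: measurable_borel_lebesgue.
split.
  have -> : letter_density h b = ((letter_fun h b : T -> R) \_ (`[0, 1]%classic : set T)).
    apply/funext => x; rewrite /letter_density patchE unit_indE mem_setE in_itv/=.
    by case: (_ <= _ <= _); rewrite ?mul1r ?mul0r.
  apply/(measurable_restrictT _ m01); case: b => //=.
  by apply: measurable_funB => //; exact: measurable_cst.
exists 1 => x; rewrite ger0_norm ?letter_density_ge0// mul1r /letter_density.
rewrite unit_indE; have [x01|_] := boolP (0 <= (x : R) <= 1); last by rewrite mul0r.
have : `[0, 1]%classic (h x) by apply: h01; rewrite /= in_itv.
by rewrite /= in_itv /= mul1r /letter_fun => /andP[hx0 hx1]; case: b => //; rewrite gerBl.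
Qed.

Lemma letter_densityD h x :
  letter_density h false x + letter_density h true x = unit_ind x.
Proof. by rewrite /letter_density /letter_fun -mulrDr subrK mulr1. Qed.

Lemma continuous_word_tail h u : in_W h -> continuous (word_tail h u).
Proof.
move=> Wh; elim: u => [|b u IH] /=; first by move=> x; exact: cst_continuous.
by apply: continuous_tail; exact: (densityMr (density_letter b Wh) IH).
Qed.

(** The points form a list rather than a tuple, so that the recursion follows
    both the word and the points and needs no transport of lengths. *)
Fixpoint word_fun h u y (s : seq R) : R :=
  match u, s with
  | b :: u', x :: s' => letter_density h b x * (y < x)%R%:R * word_fun h u' x s'
  | _, _ => 1
  end.

Lemma word_fun_ge0 h u y s : in_W h -> 0 <= word_fun h u y s.
Proof.
move=> Wh; elim: u y s => [//|b u IH] y [//|x s] /=.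
by apply: mulr_ge0 => //; apply: mulr_ge0 => //; exact: letter_density_ge0.
Qed.

Lemma measurable_word_fun h u : in_W h ->
  measurable_fun [set: T * (size u).-tuple T]
    (fun p => word_fun h u p.1 (p.2 : seq T)).
Proof.
move=> Wh; elim: u => [|b u IH]; first exact: measurable_cst.
have mhd : measurable_fun [set: T * (size u).+1.-tuple T]
    (fun p => thead p.2 : T).
  exact: (measurableT_comp (@measurable_tnth _ T _ ord0) measurable_snd).
have mtl : measurable_fun [set: T * (size u).+1.-tuple T]
    (fun p => [tuple of behead p.2] : (size u).-tuple T).
  exact: (measurableT_comp (@measurable_behead _ T _) measurable_snd).
have -> : (fun p : T * (size (b :: u)).-tuple T =>
    word_fun h (b :: u) p.1 (p.2 : seq T)) =
  (fun p => letter_density h b (thead p.2) * (p.1 < thead p.2 :> R)%R%:R *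
     word_fun h u (thead p.2) [tuple of behead p.2]).
  by apply/funext => -[y t]; case/tupleP: t => x t /=; rewrite theadE.
apply: measurable_funM; last first.
  exact: (measurableT_comp IH (measurable_fun_pair mhd mtl)).
apply: measurable_funM; first exact: (measurableT_comp (density_letter b Wh).1 mhd).
apply: (@measurableT_comp _ _ _ _ _ _ (fun b : bool => (b%:R : R))) => //.
apply: measurable_fun_ltr.
  exact: (measurableT_comp (@measurable_lebesgueR_id R) measurable_fst).
exact: (measurableT_comp (@measurable_lebesgueR_id R) mhd).
Qed.

(** The tuple measure is built by adding one coordinate in front, so Tonelli
    peels off the first letter, which is the recursion that defines
    [word_tail]. *)
Lemma integral_word_fun h u y : in_W h ->
  (\int[lebesgue_tuple R (size u)]_t (word_fun h u y (t : seq T))%:E)%E =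
  (word_tail h u y)%:E.
Proof.
move=> Wh; elim: u y => [|b u IH] y.
  by rewrite /= integral_dirac// diracT mul1e.
have mw (z : R) v : measurable_fun [set: (size v).-tuple T]
    (fun t => (word_fun h v z (t : seq T))%:E).
  apply/measurable_EFinP.
  exact: (measurableT_comp (@measurable_word_fun h v Wh) (pair1_measurable (z : T))).
transitivity (\int[pushforward (mu \x lebesgue_tuple R (size u))
    (@tuple_cons T (size u))]_t (word_fun h (b :: u) y (t : seq T))%:E)%E; first by [].
rewrite ge0_integral_pushforward//=; last 3 first.
- exact: measurable_tuple_cons.
- exact: (mw y (b :: u)).
- by move=> t _; rewrite lee_fin (word_fun_ge0 (b :: u)).
rewrite preimage_setT fubini_tonelli1; last 2 first.
- exact: (measurableT_comp (mw y (b :: u)) (@measurable_tuple_cons _ T (size u))).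
- by move=> p; rewrite lee_fin; exact: (@word_fun_ge0 h (b :: u) y (p.1 :: p.2)).

rewrite EFin_tail; last first.
  by apply: densityMr; [exact: density_letter|exact: continuous_word_tail].
apply: eq_integral => x _; rewrite /fubini_F /=.
rewrite [in RHS]mulrAC EFinM -IH -ge0_integralZl//=.
- exact: (mw x u).
- by move=> t _; rewrite lee_fin; exact: word_fun_ge0.
- by rewrite lee_fin; apply: mulr_ge0 => //; exact: letter_density_ge0.
Qed.

Lemma word_funE h u y (s : seq R) : size s = size u ->
  word_fun h u y s =
  if path <%R y s && all [pred x | 0 <= x <= 1] s
  then \prod_(i < size u) letter_fun h (nth false u i) (nth 0 s i) else 0.
Proof.
elim: u y s => [|b u IH] y [|x s]//=; first by rewrite big_ord0.
move=> [ss]; rewrite IH// /letter_density unit_indE /= big_ord_recl /=.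
case: (y < x); last by rewrite mulr0 mul0r.
by case: (0 <= x <= 1); case: path; case: all; rewrite /= ?(mulr1, mul1r, mulr0, mul0r).
Qed.

Lemma mem_ordered_simplex n (t : n.-tuple T) :
  (t \in @ordered_simplex R n) =
  path <%R (-1 : R) (t : seq R) && all [pred x | 0 <= x <= 1] (t : seq R).
Proof.
have tE (i : 'I_n) : tnth t i = nth 0 (t : seq R) i by exact: tnth_nth.
apply/idP/idP.
  rewrite inE => -[t01 tlt].
  have at01 : all [pred x : R | 0 <= x <= 1] (t : seq R).
    apply/(@all_nthP R _ _ 0) => i; rewrite size_tuple => ltin.
    by have := t01 (Ordinal ltin); rewrite tE in_itv.
  rewrite at01 andbT lt_path_sortedE; apply/andP; split.
    apply/allP => x xt; have /andP[x0 _] := allP at01 x xt.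
    by apply: lt_le_trans x0; rewrite ltrN10.
  rewrite lt_sorted_pairwise; apply/(pairwiseP (0 : R)) => i j.
  rewrite !inE !size_tuple => ltin ltjn ij.
  by have := tlt (Ordinal ltin) (Ordinal ltjn) ij; rewrite !tE.
move=> /andP[pt /(@all_nthP R _ _ 0) at01]; rewrite inE; split => [i|i j ij].
  by rewrite tE in_itv; apply: at01; rewrite size_tuple.
move: pt; rewrite lt_path_sortedE lt_sorted_pairwise => /andP[_].
by move=> /(pairwiseP (0 : R))/(_ i j); rewrite !tE !inE !size_tuple; exact.
Qed.

(** The integrand vanishes off the unit interval, so any starting point
    [y <= 0] gives the same integral; [-1] lies strictly below all of the simplex,
    including its points with [x_1 = 0]. *)
Lemma word_densityE h u : in_W h ->
  word_density u h = (size u)`!%:R * word_tail h u 0.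
Proof.
move=> Wh; rewrite /word_density; congr (_ * _).
transitivity (word_tail h u (-1)); last first.
  case: u => [//|b u]; apply: tail_le0; last by rewrite lerN10.
  by apply: densityMr; [exact: density_letter|exact: continuous_word_tail].
rewrite Rintegral_mkcond /Rintegral -[RHS]/(fine (word_tail h u (-1))%:E).
rewrite -integral_word_fun//; congr fine; apply: eq_integral => t _.
congr EFin; rewrite patchE mem_ordered_simplex word_funE ?size_tuple//.
case: ifP => // _; apply: eq_bigr => i _.
by rewrite (tnth_nth false) (tnth_nth (0 : R)).
Qed.

End words.

(** * Monomials in tail integrals as combinations of words *)

Section moments.
Context (R : realType).
Local Notation T := (lebesgueR R).
Local Notation mu := (lebesgue1 R).
Implicit Types (f h : R -> R) (phi psi : T -> R) (y : R).

Lemma continuous_mul (F G : R -> R) :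
  continuous F -> continuous G -> continuous (fun x => F x * G x).
Proof. by move=> cF cG x; apply: cvgM; [exact: cF|exact: cG]. Qed.

Lemma continuous_exp (F : R -> R) n : continuous F -> continuous (fun x => F x ^+ n).
Proof.
move=> cF; elim: n => [|n IH]; first by move=> x; exact: cst_continuous.
by under eq_fun do rewrite exprS; exact: continuous_mul.
Qed.

Lemma eq_tail phi psi y : phi =1 psi -> tail phi y = tail psi y.
Proof. by move=> e; apply: eq_Rintegral => x _; exact: e. Qed.

Lemma pow_density_ge0 phi n (x : T) : (forall x, 0 <= phi x) ->
  0 <= n.+1%:R * (phi x * tail phi x ^+ n).
Proof.
move=> phi0; apply: mulr_ge0 => //; apply: mulr_ge0 => //.
by apply: exprn_ge0; exact: tail_ge0.
Qed.

Lemma tail_exp phi y n : density phi -> (forall x, 0 <= phi x) ->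
  tail phi y ^+ n.+1 = tail (fun x : T => n.+1%:R * (phi x * tail phi x ^+ n)) y.
Proof.
move=> dphi phi0; elim: n y => [|n IH] y.
  by rewrite expr1; apply: eq_tail => x; rewrite expr0 mulr1 mul1r.
have dpow m : density (fun x : T => m.+1%:R * (phi x * tail phi x ^+ m)).
  by apply/densityZ/densityMr => //; apply/continuous_exp/continuous_tail.
rewrite exprSr IH tail_mul//; last first.
  by move=> x; exact: pow_density_ge0.
apply: eq_tail => x; rewrite -IH exprSr [n.+2%:R]mulrS; ring.
Qed.

(** [ones h] plays the role of the distribution function of [h], measured from
    the right end; the curve drawn by [(unit_tail x, ones h x)] is the main
    object of the proof. *)
Definition ones h : R -> R := tail (letter_density h true).
Definition unit_tail : R -> R := tail (@unit_ind R).

Lemma unit_ind_ge0 (x : T) : 0 <= unit_ind x :> R.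
Proof. by rewrite unit_indE. Qed.

Lemma continuous_monomial h a b : in_W h ->
  continuous (fun x => unit_tail x ^+ a * ones h x ^+ b).
Proof.
move=> Wh; apply: continuous_mul; apply: continuous_exp; apply: continuous_tail.
  exact: density_unit_ind.
exact: density_letter.
Qed.

(** Up to sign, the derivative of a monomial in the two primitives. The truncated
    predecessors are harmless because their coefficients are then zero. *)
Lemma monomial_tail h a b y : in_W h -> (0 < a + b)%N ->
  unit_tail y ^+ a * ones h y ^+ b =
  tail (fun x : T =>
    a%:R * (unit_ind x * (unit_tail x ^+ a.-1 * ones h x ^+ b)) +
    b%:R * (letter_density h true x * (unit_tail x ^+ a * ones h x ^+ b.-1))) y.
Proof.
move=> Wh; have dg := density_letter true Wh.
have g0 x : 0 <= letter_density h true x by exact: letter_density_ge0.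
have du := @density_unit_ind R; have u0 := unit_ind_ge0.
case: a => [|a]; case: b => [|b] // _.
- rewrite expr0 mul1r [LHS]tail_exp//; apply: eq_tail => x.
  by rewrite mul0r add0r expr0 mul1r.
- rewrite expr0 mulr1 [LHS]tail_exp//; apply: eq_tail => x.
  by rewrite mul0r addr0 expr0 mulr1.
have dpow phi n : density phi ->
    density (fun x : T => n.+1%:R * (phi x * tail phi x ^+ n)).
  by move=> dphi; apply/densityZ/(densityMr dphi)/continuous_exp/continuous_tail.
rewrite /unit_tail (tail_exp y a du u0) /ones (tail_exp y b dg g0).
rewrite (tail_mul y (dpow _ a du) (dpow _ b dg)); last 2 first.
- by move=> x; exact: pow_density_ge0.
- by move=> x; exact: pow_density_ge0.
apply: eq_tail => x; rewrite -(tail_exp x a du u0) -(tail_exp x b dg g0) /=.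
by ring.
Qed.

Fixpoint words (n : nat) : seq (seq bool) :=
  if n is n'.+1 then
    [seq false :: w | w <- words n'] ++ [seq true :: w | w <- words n']
  else [:: [::]].

Lemma size_words n : size (words n) = (2 ^ n)%N.
Proof. by elim: n => //= n IH; rewrite size_cat !size_map IH expnS mul2n addnn. Qed.

Lemma mem_words n w : (w \in words n) = (size w == n).
Proof.
elim: n w => [|n IH] [|b w]; rewrite ?inE//= mem_cat.
  by apply/negbTE; rewrite negb_or; apply/andP; split; apply/mapP => -[].
rewrite eqSS -IH; have inj c : injective (cons c : seq bool -> _) by move=> ? ? [].
have memF (c d : bool) s : c != d -> (c :: w \in [seq d :: v | v <- s]) = false.
  by move=> cd; apply/negbTE/mapP => -[v _ [/eqP]]; rewrite (negbTE cd).
by case: b; rewrite mem_map// memF// orbF.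
Qed.

(** Differentiating a monomial [a] times along [unit_tail] and [b] times along
    [ones] amounts to placing [a] labels that accept any letter and [b] labels
    that accept only the letter [1]; this counts the labelings compatible with
    the word, provided that its length is [a + b]. *)
Fixpoint label_count (a b : nat) (w : seq bool) : nat :=
  if w is l :: w' then
    (a * label_count a.-1 b w' + l * b * label_count a b.-1 w')%N
  else 1.

Lemma density_word h l w : in_W h ->
  density (fun x : T => letter_density h l x * word_tail h w x).
Proof.
by move=> Wh; apply: densityMr; [exact: density_letter|exact: continuous_word_tail].
Qed.

(** The point of this identity is that its coefficients do not depend on [h]. A
    label of the first kind contributes the density [unit_ind], which is the sum
    of the densities of the two letters. *)
Lemma monomial_words h n a b y : in_W h -> (a + b)%N = n ->
  unit_tail y ^+ a * ones h y ^+ b =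
  \sum_(w <- words n) (label_count a b w)%:R * word_tail h w y.
Proof.
move=> Wh; elim: n a b y => [|n IH] a b y abn.
  move/eqP : abn; rewrite addn_eq0 => /andP[/eqP-> /eqP->].
  by rewrite big_seq1 !mulr1.
rewrite monomial_tail ?abn// big_cat !big_map/=.
have dsum l (c : seq bool -> nat) : density (fun x : T =>
    \sum_(w <- words n) (c w)%:R * (letter_density h l x * word_tail h w x)).
  by apply: density_sum => w; exact/densityZ/density_word.
have tsum l (c : seq bool -> nat) :
    \sum_(w <- words n) (c w)%:R * word_tail h (l :: w) y =
    tail (fun x : T =>
      \sum_(w <- words n) (c w)%:R * (letter_density h l x * word_tail h w x)) y.
  rewrite tail_sum => [|w]; last exact/densityZ/density_word.
  by apply: eq_bigr => w _; rewrite (tailZ _ y (density_word l w Wh)).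
rewrite !tsum -tailD//.
apply: eq_tail => x; rewrite -(letter_densityD h).
have Ea : a%:R * (unit_tail x ^+ a.-1 * ones h x ^+ b) =
    \sum_(w <- words n) (a * label_count a.-1 b w)%:R * word_tail h w x.
  case: a abn => [|a] abn; first by rewrite mul0r big1// => w _; rewrite mul0r.
  rewrite IH; last by move: abn => [].
  by rewrite mulr_sumr; apply: eq_bigr => w _; rewrite natrM mulrA.
have Eb : b%:R * (unit_tail x ^+ a * ones h x ^+ b.-1) =
    \sum_(w <- words n) (b * label_count a b.-1 w)%:R * word_tail h w x.
  case: b abn {Ea} => [|b] abn; first by rewrite mul0r big1// => w _; rewrite mul0r.
  rewrite IH; last by move: abn; rewrite addnS => -[].
  by rewrite mulr_sumr; apply: eq_bigr => w _; rewrite natrM mulrA.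
rewrite mulrCA Ea [X in _ + X]mulrCA Eb mulrDl -addrA; congr (_ + _).
  rewrite mulr_sumr; apply: eq_bigr => w _.
  by rewrite mul0n addn0 mulrCA.
rewrite -mulrDr -big_split/= mulr_sumr; apply: eq_bigr => w _.
by rewrite mul1n natrD -mulrDl mulrCA.
Qed.

End moments.

(** * Moments determined by word densities *)

Section determined.
Context (R : realType).
Local Notation T := (lebesgueR R).
Implicit Types (f h : R -> R) (y : R).

(** Only words whose first letter is [1] are compared: for a single polynomial
    piece the bound on the number of words is too small for all the words of the
    required lengths. *)
Definition agree_on_words (lo N : nat) h f := forall w, (lo <= size w <= N)%N ->
  word_density (true :: w) h = word_density (true :: w) f.

Definition ones_moment h a b : R :=
  tail (fun x : T => letter_density h true x * (unit_tail x ^+ a * ones h x ^+ b)) 0.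

Definition unit_moment h a b : R :=
  tail (fun x : T => unit_ind x * (unit_tail x ^+ a * ones h x ^+ b)) 0.

Lemma ones_moment_words h a b : in_W h ->
  ones_moment h a b =
  \sum_(w <- words (a + b)) (label_count a b w)%:R * word_tail h (true :: w) 0.
Proof.
move=> Wh; have dw w := density_word true w Wh.
transitivity (\sum_(w <- words (a + b)) tail (fun x : T =>
    (label_count a b w)%:R * (letter_density h true x * word_tail h w x)) 0).
  rewrite -tail_sum => [|w]; last exact/densityZ/dw.
  apply: eq_tail => x; rewrite (monomial_words x Wh erefl) mulr_sumr.
  by apply: eq_bigr => w _; rewrite mulrCA.
by apply: eq_bigr => w _; rewrite tailZ//; exact: dw.
Qed.

Lemma agree_ones_moment lo N h f a b : in_W h -> in_W f -> agree_on_words lo N h f ->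
  (lo <= a + b <= N)%N -> ones_moment h a b = ones_moment f a b.
Proof.
move=> Wh Wf hf abN; rewrite !ones_moment_words//.
rewrite !big_seq; apply: eq_bigr => w; rewrite mem_words => /eqP sw.
congr (_ * _); have := hf w; rewrite sw => /(_ abN).
rewrite !word_densityE// => /mulfI; apply.
by rewrite pnatr_eq0 -lt0n fact_gt0.
Qed.

Lemma unit_tail0 : unit_tail 0 = 1 :> R.
Proof. by rewrite /unit_tail tail_unit_ind ?subr0// lexx ler01. Qed.

(** The total mass [ones h 0] is thus determined by any one moment of this kind,
    so that words shorter than [lo + 1] are never needed to recover it. *)
Lemma ones_exp h n : in_W h -> ones h 0 ^+ n.+1 = n.+1%:R * ones_moment h 0 n.
Proof.
move=> Wh; have dg := density_letter true Wh.
rewrite -[LHS]mul1r -(expr0 (unit_tail 0)) monomial_tail// /ones_moment -tailZ.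
  by apply: eq_tail => x; rewrite mul0r add0r.
exact/densityMr/continuous_monomial.
Qed.

Lemma agree_ones0 lo N h f : in_W h -> in_W f -> agree_on_words lo N h f -> (lo <= N)%N ->
  ones h 0 = ones f 0.
Proof.
move=> Wh Wf hf loN; apply/eqP; rewrite -(@eqrXn2 _ N.+1)//.
- have N0 : (lo <= 0 + N <= N)%N by rewrite add0n loN leqnn.
  by rewrite (ones_exp N Wh) (ones_exp N Wf) (agree_ones_moment Wh Wf hf N0).
- by apply: tail_ge0 => x; exact: letter_density_ge0.
- by apply: tail_ge0 => x; exact: letter_density_ge0.
Qed.

(** Integration by parts trades the moment against [unit_ind], whose first letter
    is free, for one against the letter [1]. *)
Lemma unit_moment_ones h a b : in_W h ->
  a.+1%:R * unit_moment h a b.+1 = ones h 0 ^+ b.+1 - b.+1%:R * ones_moment h a.+1 b.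
Proof.
move=> Wh; have dg := density_letter true Wh; have du := @density_unit_ind R.
apply/eqP; rewrite eq_sym subr_eq; apply/eqP.
have -> : ones h 0 ^+ b.+1 = unit_tail 0 ^+ a.+1 * ones h 0 ^+ b.+1.
  by rewrite unit_tail0 expr1n mul1r.
rewrite monomial_tail//.
have dm (phi : T -> R) c i j : density phi ->
    density (fun x : T => c * (phi x * (unit_tail x ^+ i * ones h x ^+ j))).
  by move=> dphi; apply/densityZ/densityMr => //; exact: continuous_monomial.
rewrite -!tailZ;
  [|exact/densityMr/continuous_monomial|exact/densityMr/continuous_monomial].
by rewrite -tailD; [|exact: dm|exact: dm].
Qed.

(** When [b = 0] the moment does not involve [h] at all, so no word is needed. *)
Lemma agree_unit_moment lo N h f a b : in_W h -> in_W f -> agree_on_words lo N h f ->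
  (lo <= N)%N -> ((0 < b)%N -> (lo <= a + b <= N)%N) ->
  unit_moment h a b = unit_moment f a b.
Proof.
move=> Wh Wf hf loN; case: b => [|b] abN; first by apply: eq_tail => x; rewrite !expr0.
apply: (@mulfI _ a.+1%:R); first by rewrite pnatr_eq0.
have abN' : (lo <= a.+1 + b <= N)%N by rewrite addSnnS abN.
rewrite [LHS](unit_moment_ones a b Wh) [RHS](unit_moment_ones a b Wf).
by rewrite (agree_ones0 Wh Wf hf loN) (agree_ones_moment Wh Wf hf abN').
Qed.

Lemma continuous_poly2 (B : {poly {poly R}}) (F G : R -> R) :
  continuous F -> continuous G -> continuous (fun x => B.[(G x)%:P].[F x]).
Proof.
move=> cF cG; elim/poly_ind: B => [|B c IH].
  by under eq_fun do rewrite !horner0; move=> x; exact: cst_continuous.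
under eq_fun do rewrite hornerMXaddC hornerD hornerM hornerC.
move=> x; apply: cvgD; first by apply: cvgM; [exact: IH|exact: cG].
by apply: continuous_comp; [exact: cF|exact: continuous_horner].
Qed.

(** The integral of [B(z, H)] along the curve [z = unit_tail x],
    [H = ones h x]; the outer variable of [B] is [H]. *)
Definition poly_integral h (B : {poly {poly R}}) : R :=
  tail (fun x : T => unit_ind x * B.[(ones h x)%:P].[unit_tail x]) 0.

Lemma poly_integralE h B : in_W h -> poly_integral h B =
  \sum_(b < size B) \sum_(a < size B`_b) B`_b`_a * unit_moment h a b.
Proof.
move=> Wh; have du := @density_unit_ind R.
have dm a b : density (fun x : T => unit_ind x * (unit_tail x ^+ a * ones h x ^+ b)).
  exact/densityMr/continuous_monomial.
transitivity (\sum_(b < size B) tail (fun x : T => \sum_(a < size B`_b)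
    B`_b`_a * (unit_ind x * (unit_tail x ^+ a * ones h x ^+ b))) 0).
  rewrite -tail_sum => [|b]; last by apply: density_sum => a; exact: densityZ.
  apply: eq_tail => x; rewrite (horner_coef B) horner_sum mulr_sumr.
  apply: eq_bigr => b _; rewrite hornerM -rmorphXn hornerC (horner_coef B`_b).
  rewrite mulr_suml mulr_sumr; apply: eq_bigr => a _; ring.
apply: eq_bigr => b _; rewrite tail_sum => [|a]; last exact: densityZ.
by apply: eq_bigr => a _; rewrite tailZ.
Qed.

Lemma agree_poly_integral lo N h f (B : {poly {poly R}}) :
  in_W h -> in_W f -> agree_on_words lo N h f -> (lo <= N)%N ->
  (forall a b, (0 < b)%N -> B`_b`_a != 0 -> (lo <= a + b <= N)%N) ->
  poly_integral h B = poly_integral f B.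
Proof.
move=> Wh Wf hf loN BN.
rewrite (poly_integralE B Wh) (poly_integralE B Wf).
apply: eq_bigr => b _; apply: eq_bigr => a _.
have [Bab|Bab] := eqVneq B`_b`_a 0; first by rewrite Bab [LHS]mul0r [RHS]mul0r.
apply: (congr1 ( *%R B`_b`_a)); apply: (agree_unit_moment Wh Wf hf loN) => b0.
exact: BN.
Qed.

End determined.

(** * Sign changes and polynomials *)

Section signs.
Context (R : realType).
Implicit Types (p q : {poly R}) (Delta : R -> R) (C : seq R) (s : seq {poly R}).

Lemma poly_roots_seq p : p != 0 ->
  exists C, (size C < size p)%N /\ forall x, root p x -> x \in C.
Proof.
have [n] := ubnP (size p); elim: n p => // n IH p ltpn p0.
have [[x px]|npx] := pselect (exists x, root p x); last first.
  exists [::]; rewrite lt0n size_poly_eq0 p0; split => // x px.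
  by exfalso; apply: npx; exists x.
have [q pE] := factor_theorem p x px.
have q0 : q != 0 by apply: contraNneq p0 => q0; rewrite pE q0 mul0r.
have sp : size p = (size q).+1 by rewrite pE size_Mmonic ?monicXsubC// size_XsubC addn2.
have [|C [sC qC]] := IH q _ q0; first by rewrite -ltnS -sp.
exists (x :: C); rewrite sp; split => // z.
by rewrite pE rootM root_XsubC inE => /orP[/qC->|->]; rewrite ?orbT.
Qed.

Lemma exists_notin_itv C (a b : R) : a < b -> exists2 x, a < x < b & x \notin C.
Proof.
elim: C a b => [|c C IH] a b ab; first by exists ((a + b) / 2) => //; lra.
pose m := (a + b) / 2; have am : a < m by rewrite /m; lra.
have mb : m < b by rewrite /m; lra.
have [cm|mc] := leP c m.
  have [x /andP[mx xb] xC] := IH _ _ mb.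
  exists x; first by rewrite xb andbT (lt_trans am).
  by rewrite inE negb_or xC andbT gt_eqF// (le_lt_trans cm).
have [x /andP[ax xm] xC] := IH _ _ am.
exists x; first by rewrite ax (lt_trans xm).
by rewrite inE negb_or xC andbT lt_eqF// (lt_trans xm).
Qed.

Lemma continuous_eq0_cofinite C Delta : continuous Delta ->
  (forall x, 0 <= x <= 1 -> x \notin C -> Delta x = 0) ->
  forall x, 0 <= x <= 1 -> Delta x = 0.
Proof.
move=> cD D0 c /andP[c0 c1]; apply/eqP/contraT => Dc.
have Dc0 : 0 < `|Delta c| by rewrite normr_gt0.
have /cvgrPdist_lt/(_ _ Dc0)[e /= e0 eD] := cD c.
pose a := Num.max 0 (c - e / 2); pose b := Num.min 1 (c + e / 2).
have ab : a < b.
  by rewrite /a /b gt_max !lt_min -!andbA; apply/and4P; split; lra.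
have [x /andP[ax xb] xC] := exists_notin_itv C ab.
move: ax xb; rewrite /a /b gt_max lt_min => /andP[x0 cx] /andP[x1 xc].
have : `|Delta c - Delta x| < `|Delta c|.
  by apply: eD; rewrite /ball_/= ltr_norml; lra.
by rewrite (D0 x)// ?subr0 ?ltxx// (ltW x0) (ltW x1).
Qed.

(** Compactness of [`[u, v]], one polynomial at a time. *)
Lemma no_root_lower_bound s (u v : R) : u <= v ->
  (forall g x, g \in s -> u <= x <= v -> g.[x] != 0) ->
  exists2 e, 0 < e & forall g x, g \in s -> u <= x <= v -> e <= `|g.[x]|.
Proof.
move=> uv; elim: s => [|g s IH] gs; first by exists 1.
have [|e e0 es] := IH; first by move=> g' x g's; apply: gs; rewrite inE g's orbT.
have cg : {within `[u, v], continuous (fun x => `|g.[x]|)}.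
  apply: continuous_subspaceT => x.
  by apply: continuous_comp; [exact: continuous_horner|exact: norm_continuous].
have [c cuv gc] := EVT_min uv cg.
exists (Num.min e `|g.[c]|).
  by rewrite lt_min e0 normr_gt0 gs ?mem_head//; move: cuv; rewrite in_itv.
move=> g' x; rewrite inE => /predU1P[->|g's] xuv; last by rewrite ge_min es.
by rewrite ge_min gc ?orbT// in_itv.
Qed.

(** Between crossings a nonzero value of [Delta] is bounded away from [0]. A
    change of sign would force, by the intermediate value theorem, values that
    are too small. *)
Lemma no_sign_change s Delta (u v : R) : u <= v -> continuous Delta ->
  (forall x, u <= x <= v -> Delta x = 0 \/ exists2 g, g \in s & Delta x = g.[x]) ->
  (forall g x, g \in s -> u <= x <= v -> g.[x] != 0) ->
  0 <= Delta u * Delta v.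
Proof.
move=> uv cD Ds gs; have [e e0 es] := no_root_lower_bound uv gs.
rewrite leNgt; apply/negP => Duv.
have Dlarge x : u <= x <= v -> Delta x != 0 -> e <= `|Delta x|.
  move=> xuv; have [->|[g gs' ->] _] := Ds x xuv; first by rewrite eqxx.
  exact: es.
have Du0 : Delta u != 0 by apply: contraTneq Duv => ->; rewrite mul0r ltxx.
have Dv0 : Delta v != 0 by apply: contraTneq Duv => ->; rewrite mulr0 ltxx.
have eu : e <= `|Delta u| by apply: Dlarge => //; rewrite lexx.
have ev : e <= `|Delta v| by apply: Dlarge => //; rewrite lexx uv.
have [|c] := @IVT R Delta u v (e / 2) uv (continuous_subspaceT cD).
  rewrite ge_min le_max; move: eu ev Duv; rewrite !ler_normr.
  move=> /orP[]eu /orP[]ev Duv; try (apply/andP; split; apply/orP; lra).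
  - by exfalso; nra.
  - by exfalso; nra.
rewrite in_itv/= => cuv Dc; have := Dlarge c cuv.
rewrite Dc gtr0_norm ?divr_gt0// gt_eqF ?divr_gt0//= => /(_ isT); lra.
Qed.

(** If [Delta] changes sign only across [C], some polynomial changes sign at the
    same places. By induction on [C]: at each point put a simple root if
    [Delta] flips there and a double root otherwise. Either way the product
    vanishes at the point itself, where the hypothesis says nothing about
    [Delta]. *)
Lemma sign_matching_poly C Delta :
  (forall u v, 0 <= u -> u < v -> v <= 1 ->
     (forall c, c \in C -> ~~ (u <= c <= v)) -> 0 <= Delta u * Delta v) ->
  exists p, [/\ (size p <= (2 * size C).+1)%N,
    forall x, root p x -> x \in C &
    forall x, 0 <= x <= 1 -> 0 <= p.[x] * Delta x].
Proof.
elim: C Delta => [|c C IH] Delta DC.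
  have [[u /andP[u0 u1] Du]|nu] := pselect (exists2 u, 0 <= u <= 1 & Delta u < 0).
    exists (-1); rewrite size_polyN size_poly1; split => //.
      by move=> x; rewrite rootN (negbTE (root1 x)).
    move=> x /andP[x0 x1]; rewrite hornerN hornerC mulN1r oppr_ge0.
    have [xu|ux|->] := ltgtP x u; last exact: ltW.
      by have := DC x u x0 xu u1 (fun c cn => ltac:(by [])); rewrite nmulr_lge0.
    by have := DC u x u0 ux x1 (fun c cn => ltac:(by [])); rewrite nmulr_rge0.
  exists 1; rewrite size_poly1; split => //.
    by move=> x; rewrite (negbTE (root1 x)).
  by move=> x x01; rewrite hornerC mul1r leNgt; apply/negP => Dx; apply: nu; exists x.
pose flips u v := [/\ 0 <= u < c, c < v <= 1,
  forall d, d \in C -> ~~ (u <= d <= v) & Delta u * Delta v < 0].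
have extend (q : {poly R}) : (size q <= 3)%N -> (forall x, root q x -> x = c) ->
    (forall u v, 0 <= u -> u < v -> v <= 1 ->
      (forall d, d \in C -> ~~ (u <= d <= v)) ->
      0 <= (q.[u] * Delta u) * (q.[v] * Delta v)) ->
    exists p, [/\ (size p <= (2 * size (c :: C)).+1)%N,
      forall x, root p x -> x \in c :: C &
      forall x, 0 <= x <= 1 -> 0 <= p.[x] * Delta x].
  move=> sq qc qD; have [p [sp pC pD]] := IH (fun x => q.[x] * Delta x) qD.
  exists (p * q); split.
  - rewrite (leq_trans (size_polyMleq _ _))//=; move: sp sq.
    by set m := size p; set n := size q; lia.
  - by move=> x; rewrite rootM inE => /orP[/pC->|/qc->]; rewrite ?orbT ?eqxx.
  - by move=> x /pD; rewrite hornerM mulrA.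
have away u v : 0 <= u -> u < v -> v <= 1 ->
    (forall d, d \in C -> ~~ (u <= d <= v)) -> ~~ (u <= c <= v) ->
    0 <= Delta u * Delta v.
  move=> u0 uv v1 uvC uvc; apply: DC => // d; rewrite inE => /predU1P[->//|].
  exact: uvC.
have [[u0 [v0 [/andP[u00 u0c] /andP[cv0 v01] uvC0 D0]]]|noflip] :=
    pselect (exists u v, flips u v).
  apply: (extend ('X - c%:P)).
  - by rewrite size_XsubC.
  - by move=> x; rewrite root_XsubC => /eqP.
  move=> u v u_ge0 uv v_le1 uvC; rewrite !hornerXsubC.
  have [uc|cu] := leP u c; last first.
    have := away u v u_ge0 uv v_le1 uvC; rewrite (lt_geF cu) => /(_ isT) D0'.
    by rewrite mulrACA mulr_ge0// mulr_ge0// subr_ge0; lra.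
  have [cv|vc] := leP c v; last first.
    have := away u v u_ge0 uv v_le1 uvC; rewrite (lt_geF vc) andbF => /(_ isT) D0'.
    by rewrite mulrACA mulr_ge0// mulr_le0// subr_le0; lra.
  have [->|uNc] := eqVneq u c; first by rewrite subrr !mul0r.
  have [->|vNc] := eqVneq v c; first by rewrite subrr mul0r mulr0.
  have {uNc uc}uc : u < c by rewrite lt_neqAle uNc.
  have {vNc cv}cv : c < v by rewrite lt_neqAle eq_sym vNc.
  (* u and u0 lie on the same side of c, and so do v and v0, so the flip seen at
     (u0, v0) is also the one at (u, v), up to zero values. *)
  have Du : 0 <= Delta u * Delta u0.
    have [uu0|u0u|->] := ltgtP u u0; last by rewrite -expr2 sqr_ge0.
      apply: away => //; [lra| |by rewrite (lt_geF u0c) andbF].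
      move=> d dC; apply: contra (uvC d dC) => /andP[-> du0] /=; lra.
    rewrite mulrC; apply: away => //; [lra| |by rewrite (lt_geF uc) andbF].
    move=> d dC; apply: contra (uvC0 d dC) => /andP[-> du0] /=; lra.
  have Dv : 0 <= Delta v * Delta v0.
    have [vv0|v0v|->] := ltgtP v v0; last by rewrite -expr2 sqr_ge0.
      apply: away => //; [lra| |by rewrite (lt_geF cv)].
      move=> d dC; apply: contra (uvC0 d dC) => /andP[vd ->]; rewrite andbT; lra.
    rewrite mulrC; apply: away => //; [lra| |by rewrite (lt_geF cv0)].
    move=> d dC; apply: contra (uvC d dC) => /andP[vd ->]; rewrite andbT; lra.
  have Duv : Delta u * Delta v <= 0.
    rewrite leNgt; apply/negP => Duv; have := mulr_ge0 Du Dv.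
    have := nmulr_llt0 (Delta u * Delta v) D0; rewrite Duv.
    by rewrite mulrACA => /idP; rewrite ltNge => /negP.
  have : (u - c) * (v - c) < 0 by rewrite nmulr_rlt0 ?subr_gt0// subr_lt0.
  by rewrite mulrACA => quv; rewrite mulr_le0// ltW.
apply: (extend (('X - c%:P) ^+ 2)).
- by rewrite size_exp_XsubC.
- by move=> x; rewrite rootE horner_exp hornerXsubC sqrf_eq0 subr_eq0 => /eqP.
move=> u v u_ge0 uv v_le1 uvC; rewrite !horner_exp !hornerXsubC mulrACA.
have [uc|cu] := leP u c; last first.
  have := away u v u_ge0 uv v_le1 uvC; rewrite (lt_geF cu) => /(_ isT) D0.
  by rewrite mulr_ge0// mulr_ge0// sqr_ge0.
have [cv|vc] := leP c v; last first.
  have := away u v u_ge0 uv v_le1 uvC; rewrite (lt_geF vc) andbF => /(_ isT) D0.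
  by rewrite mulr_ge0// mulr_ge0// sqr_ge0.
have [->|uNc] := eqVneq u c; first by rewrite subrr expr0n !mul0r.
have [->|vNc] := eqVneq v c; first by rewrite subrr expr0n mulr0 mul0r.
apply: mulr_ge0; first by apply: mulr_ge0; exact: sqr_ge0.
rewrite leNgt; apply/negP => D0; apply: noflip; exists u, v; split => //.
  by rewrite u_ge0 lt_neqAle uNc.
by rewrite v_le1 andbT lt_neqAle eq_sym vNc.
Qed.

End signs.

(** * The curve of a piecewise polynomial function *)

Section piecewise.
Context (R : realType).
Local Notation T := (lebesgueR R).
Implicit Types (f h : R -> R) (q : {poly R}).

(** The constant coefficient is [0] because [0%:R^-1 = 0]. *)
Definition antideriv q : {poly R} := \poly_(i < (size q).+1) (q`_i.-1 / i%:R).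

Lemma horner_antideriv q z :
  (antideriv q).[z] = \sum_(i < size q) q`_i * (z ^+ i.+1 / i.+1%:R).
Proof.
rewrite horner_poly big_ord_recl invr0 mulr0 mul0r add0r.
by apply: eq_bigr => i _; rewrite /= mulrAC mulrA.
Qed.

Lemma tail_poly q (y : R) : 0 <= y <= 1 ->
  tail (fun x : T => unit_ind x * q.[unit_tail x]) y = (antideriv q).[1 - y].
Proof.
move=> y01; have du := @density_unit_ind R.
have cp i : continuous (fun x => @unit_tail R x ^+ i).
  by apply/continuous_exp/continuous_tail.
rewrite horner_antideriv -(tail_unit_ind y01).
transitivity (\sum_(i < size q)
    tail (fun x : T => q`_i * (unit_ind x * unit_tail x ^+ i)) y).
  rewrite -tail_sum => [|i]; last exact/densityZ/densityMr.
  apply: eq_tail => x; rewrite horner_coef mulr_sumr.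
  by apply: eq_bigr => i _; rewrite mulrCA.
apply: eq_bigr => i _; rewrite tailZ; last exact: densityMr.
congr (_ * _); rewrite tail_exp//.
rewrite tailZ; last exact: densityMr.
by rewrite mulrAC mulfV ?mul1r// pnatr_eq0.
Qed.

(** On each piece the tail integral of a polynomial is a polynomial in
    [z = 1 - x] of degree one more; the constant of integration is fixed by the
    value at one point of the piece. *)
Lemma ones_piecewise k (I : 'I_k -> set R) (P : 'I_k -> {poly R}) f :
  interval_partition I -> in_W f -> (forall i x, I i x -> f x = (P i).[x]) ->
  exists Phi : 'I_k -> {poly R}, forall i,
    (size (Phi i) <= (size (P i)).+1)%N /\
    forall x, I i x -> ones f x = (Phi i).[1 - x].
Proof.
move=> [itvI [coverI _ I0]] Wf fP.
have I01 i x : I i x -> 0 <= x <= 1.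
  by move=> Ix; have : `[0, 1]%classic x; [rewrite -coverI; exists i|rewrite /= in_itv].
suff H i : exists phi : {poly R}, (size phi <= (size (P i)).+1)%N /\
    forall x, I i x -> ones f x = phi.[1 - x].
  exists (fun i => projT1 (cid (H i))) => i; exact: (projT2 (cid (H i))).
have [x0 Ix0] := I0 i Logic.I.
pose q := P i \Po (1 - 'X).
have sq : size q = size (P i).
  by rewrite size_comp_poly2// -opprB size_polyN size_XsubC.
have incr x y : I i x -> I i y -> x <= y ->
    ones f x - ones f y = (antideriv q).[1 - x] - (antideriv q).[1 - y].
  move=> Ix Iy xy; rewrite -!tail_poly; [|exact: (I01 i)|exact: (I01 i)].
  have dq : density (fun x : T => unit_ind x * q.[unit_tail x]).
    apply: densityMr; first exact: density_unit_ind.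
    move=> z; apply: continuous_comp; last exact: continuous_horner.
    by apply: continuous_tail; exact: density_unit_ind.
  rewrite (tailB_itv (density_letter true Wf) xy) (tailB_itv dq xy).
  apply: eq_Rintegral => t; rewrite mem_setE in_itv/= => /andP[xt ty].
  have It : I i t by apply: (itvI i x y) => //; rewrite (ltW xt).
  rewrite /letter_density/= (fP i)// /unit_tail tail_unit_ind ?(I01 i)//.
  by rewrite horner_comp !hornerE subKr.
exists (antideriv q + (ones f x0 - (antideriv q).[1 - x0])%:P); split.
  rewrite (leq_trans (size_polyD _ _))// geq_max; apply/andP; split.
    by rewrite (leq_trans (size_poly _ _))// sq.
  by rewrite (leq_trans (size_polyC_leq1 _)).
move=> x Ix; rewrite hornerD hornerC.
have [xx0|/ltW x0x] := leP x x0.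
  by have := incr _ _ Ix Ix0 xx0; lra.
by have := incr _ _ Ix0 Ix x0x; lra.
Qed.

Lemma poly_integral_eq0 h (B : {poly {poly R}}) : in_W h ->
  (forall x, 0 <= x <= 1 -> 0 <= B.[(ones h x)%:P].[1 - x]) ->
  poly_integral h B = 0 ->
  forall x, 0 <= x <= 1 -> B.[(ones h x)%:P].[1 - x] = 0.
Proof.
move=> Wh B0 iB x x01; rewrite -(tail_unit_ind x01).
apply: (@tail_eq0 R (fun x => B.[(ones h x)%:P].[unit_tail x])) => //.
- apply: continuous_poly2; apply: continuous_tail; first exact: density_unit_ind.
  exact: density_letter.
- by move=> y y01; rewrite /unit_tail tail_unit_ind// B0.
Qed.

(** Off the unit interval tail integrals of densities are constant, so equality
    on [`[0, 1]] is equality everywhere. *)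
Lemma eq_ones_ae h f : in_W h -> in_W f ->
  (forall x, 0 <= x <= 1 -> ones h x = ones f x) -> ae_eq01 h f.
Proof.
move=> Wh Wf hf; have dh := density_letter true Wh; have df := density_letter true Wf.
have : {ae lebesgue1 R, forall x, letter_density h true x = letter_density f true x}.
  apply: tail_inj => //; try by move=> x; exact: letter_density_ge0.
  move=> x; have [x0|/ltW x0] := leP x 0.
    by rewrite (tail_le0 dh x0) (tail_le0 df x0); apply: hf; rewrite lexx ler01.
  have [x1|/ltW x1] := leP x 1; first by apply: hf; rewrite x0.
  by rewrite !tail_ge1.
apply: filterS => x; rewrite /letter_density unit_indE => e x01.
by move: e; rewrite in_itv/= in x01; rewrite x01 !mul1r.
Qed.

(** The polynomial [\prod_i (H - Phi i (z))], whose zero set is the union of the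
    graphs of the [Phi i]. *)
Definition separator k (Phi : 'I_k -> {poly R}) : {poly {poly R}} :=
  \prod_(i < k) ('X - (Phi i)%:P).

Lemma horner_separator k (Phi : 'I_k -> {poly R}) (c z : R) :
  (separator Phi).[c%:P].[z] = \prod_(i < k) (c - (Phi i).[z]).
Proof.
rewrite /separator horner_prod horner_prod; apply: eq_bigr => i _.
by rewrite hornerXsubC hornerD hornerN hornerC.
Qed.

Definition bidegree_le (n m : nat) (B : {poly {poly R}}) :=
  (size B <= n.+1)%N /\ forall b, (size (B`_b)%R <= m.+1)%N.

Lemma bidegree_leM n m n' m' B B' : bidegree_le n m B -> bidegree_le n' m' B' ->
  bidegree_le (n + n') (m + m') (B * B').
Proof.
move=> [sB cB] [sB' cB']; split.
  rewrite (leq_trans (size_polyMleq _ _))//; move: sB sB'.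
  by set x := size B; set y := size B'; lia.
move=> b; rewrite coefM; apply: (leq_trans (size_sum _ _ _)).
apply/bigmax_leqP => i _; rewrite (leq_trans (size_polyMleq _ _))//.
have := cB i; have := cB' (b - i)%N.
by set x := size _; set y := size B`_i; lia.
Qed.

Lemma bidegree_le_separator k (Phi : 'I_k -> {poly R}) d :
  (forall i, (size (Phi i) <= d.+1)%N) ->
  bidegree_le k (k * d) (separator Phi).
Proof.
elim: k Phi => [|k IH] Phi sPhi; rewrite /separator.
  rewrite big_ord0; split; first by rewrite size_poly1.
  by move=> b; rewrite coefC; case: ifP; rewrite ?size_poly1 ?size_poly0.
rewrite big_ord_recl mulSn; apply: (@bidegree_leM 1 d k (k * d)); last first.
  by apply: (IH (fun i => Phi (lift ord0 i))) => i.
split; first by rewrite size_XsubC.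
move=> b; rewrite coefB coefX coefC (leq_trans (size_polyD _ _))// geq_max.
rewrite size_polyN; apply/andP; split.
  by case: (b == 1)%N; rewrite ?size_poly1 ?size_poly0.
by case: (b == 0)%N; rewrite ?size_poly0.
Qed.

(** The curve of [f] lies in the zero set of the separator, so the integral of
    the squared separator is [0] along it, and hence along the curve of [h]: this
    integral is determined by words. The curve of [h] may still pass from
    one graph to another where two of them cross. *)
Lemma ones_in_pieces k (Phi : 'I_k -> {poly R}) lo N f h :
  in_W h -> in_W f -> agree_on_words lo N h f -> (lo <= N)%N ->
  (forall a b, (0 < b)%N -> (separator Phi ^+ 2)`_b`_a != 0 -> (lo <= a + b <= N)%N) ->
  (forall x, 0 <= x <= 1 -> exists i, ones f x = (Phi i).[1 - x]) ->
  forall x, 0 <= x <= 1 -> exists i, ones h x = (Phi i).[1 - x].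
Proof.
move=> Wh Wf hf loN supp fPhi x x01.
have sqE g y : (separator Phi ^+ 2).[(ones g y)%:P].[1 - y] =
    (\prod_(i < k) (ones g y - (Phi i).[1 - y])) ^+ 2.
  by rewrite !expr2 hornerM hornerM horner_separator.
have f0 : poly_integral f (separator Phi ^+ 2) = 0.
  rewrite /poly_integral (@eq_tail _ _ (fun=> 0 * 0)); last first.
    move=> y; rewrite unit_indE mulr0; have [y01|_] := boolP (0 <= (y : R) <= 1).
      rewrite mul1r /unit_tail tail_unit_ind// sqE.
      have [i fi] := fPhi _ y01.
      by rewrite (bigD1 i)//= fi subrr mul0r expr0n.
    by rewrite mul0r.
  by rewrite tailZ ?mul0r//; exact: density0.
have := @poly_integral_eq0 h (separator Phi ^+ 2) Wh _ _ x x01.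
rewrite (agree_poly_integral Wh Wf hf loN supp) f0 sqE => H.
have /eqP : (\prod_(i < k) (ones h x - (Phi i).[1 - x])) ^+ 2 = 0.
  by apply: H => // y _; rewrite sqE sqr_ge0.
rewrite sqrf_eq0 prodf_seq_eq0 => /hasP[i _ /=].
by rewrite subr_eq0 => /eqP; exists i.
Qed.

End piecewise.

(** * Crossings, number of words and forcing *)

Section forcing.
Context (R : realType).
Local Notation T := (lebesgueR R).
Implicit Types (f h : R -> R).

Lemma bidegree_le_coef n m (B : {poly {poly R}}) a b :
  bidegree_le n m B -> B`_b`_a != 0 -> (a <= m)%N /\ (b <= n)%N.
Proof.
move=> [sB cB] Bab; split; rewrite leqNgt; apply: contraNN Bab => lt.
  by rewrite nth_default// (leq_trans (cB b)).
by rewrite [B`_b]nth_default ?coef0// (leq_trans sB).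
Qed.

Lemma size_prod_poly_leq (s : seq {poly R}) d :
  (forall g, g \in s -> (size g <= d.+1)%N) ->
  (size (\prod_(g <- s) g)%R <= (d * size s).+1)%N.
Proof.
elim: s => [|g s IH] sd; first by rewrite big_nil size_poly1.
rewrite big_cons (leq_trans (size_polyMleq _ _))//=.
have := sd g (mem_head _ _).
have : (size (\prod_(j <- s) j : {poly R})%R <= (d * size s).+1)%N.
  by apply: IH => j js; apply: sd; rewrite inE js orbT.
by set x := size g; set y := size (\prod_(j <- s) j : {poly R})%R; rewrite mulnS; lia.
Qed.

Definition differences k (Phi : 'I_k -> {poly R}) : seq {poly R} :=
  [seq Phi p.1 - Phi p.2 | p <- enum {: 'I_k * 'I_k} & Phi p.1 != Phi p.2].

Lemma differencesP k (Phi : 'I_k -> {poly R}) i j :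
  Phi i != Phi j -> Phi i - Phi j \in differences Phi.
Proof.
move=> ij; apply/mapP; exists (i, j) => //.
by rewrite mem_filter ij mem_enum.
Qed.

Lemma crossing_points k (Phi : 'I_k -> {poly R}) d :
  (forall i, (size (Phi i) <= d.+1)%N) ->
  exists C : seq R, (size C <= d * k ^ 2)%N /\
    forall g x, g \in differences Phi -> g.[x] = 0 -> x \in C.
Proof.
move=> sPhi; pose s := differences Phi.
have s0 : \prod_(g <- s) g != 0.
  rewrite prodf_seq_neq0; apply/allP => _ /mapP[p + ->].
  by rewrite mem_filter subr_eq0 => /andP[].
have [C [sC rC]] := poly_roots_seq s0.
exists C; split; last first.
  move=> g x gs gx; apply: rC; rewrite rootE horner_prod prodf_seq_eq0.
  by apply/hasP; exists g => //=; rewrite gx.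
have ss : (size s <= k ^ 2)%N.
  rewrite size_map size_filter (leq_trans (count_size _ _))//.
  by rewrite -cardE card_prod card_ord mulnn.
have sCs : (size C <= d * size s)%N.
  rewrite -ltnS (leq_trans sC)// size_prod_poly_leq// => _ /mapP[p _ ->].
  by rewrite (leq_trans (size_polyD _ _))// size_polyN geq_max !sPhi.
by rewrite (leq_trans sCs)// leq_mul2l ss orbT.
Qed.

(** The difference [Delta] of the two curves takes its nonzero values among the
    differences of two distinct [Phi i], so it can change sign only at one of the
    finitely many crossings. Multiplying it by a polynomial with matching signs
    gives a function of constant sign whose integral is a combination of
    moments on which [h] and [f] agree. *)
Lemma ones_eq_of_moments k (Phi : 'I_k -> {poly R}) d N f h :
  in_W h -> in_W f -> agree_on_words 1 N h f -> (2 * (d * k ^ 2) < N)%N ->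
  (forall i, (size (Phi i) <= d.+1)%N) ->
  (forall x, 0 <= x <= 1 -> exists i, ones f x = (Phi i).[1 - x]) ->
  (forall x, 0 <= x <= 1 -> exists i, ones h x = (Phi i).[1 - x]) ->
  forall x, 0 <= x <= 1 -> ones h x = ones f x.
Proof.
move=> Wh Wf hf ltN sPhi fPhi hPhi.
have [C [sC rC]] := crossing_points sPhi.
pose Delta z := ones h (1 - z) - ones f (1 - z).
have c1B : continuous (fun z : R => 1 - z).
  by move=> z; apply: cvgB; [exact: cst_continuous|exact: cvg_id].
have cones g : in_W g -> continuous (ones g).
  by move=> Wg; apply: continuous_tail; exact: density_letter.
have cD : continuous Delta.
  by move=> z; apply: cvgB; apply: (continuous_comp (c1B z)); exact: cones.
have refl01 (z : R) : 0 <= z <= 1 -> 0 <= 1 - z <= 1 by lra.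
have DPhi z : 0 <= z <= 1 ->
    Delta z = 0 \/ exists2 g, g \in differences Phi & Delta z = g.[z].
  move=> /refl01 z01; have [i hi] := hPhi _ z01; have [j fj] := fPhi _ z01.
  rewrite /Delta hi fj subKr; have [->|ij] := eqVneq (Phi i) (Phi j).
    by left; rewrite subrr.
  by right; exists (Phi i - Phi j); [exact: differencesP|rewrite hornerD hornerN].
have [|p [sp pC pD]] := @sign_matching_poly _ C Delta.
  move=> u v u0 uv v1 uvC; apply: (@no_sign_change _ (differences Phi)) => //.
  - exact: ltW.
  - by move=> x /andP[ux xv]; apply: DPhi; rewrite (le_trans u0 ux) (le_trans xv v1).
  - by move=> g x gs uxv; apply/eqP => /(rC _ _ gs)/uvC; rewrite uxv.
pose B : {poly {poly R}} := p%:P * 'X.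
have BE g y : B.[(ones g y)%:P].[1 - y] = p.[1 - y] * ones g y.
  by rewrite /B hornerMX hornerC hornerM hornerC.
have suppB a b : (0 < b)%N -> B`_b`_a != 0 -> (1 <= a + b <= N)%N.
  rewrite /B coefMX; case: b => [//|[|b]] _ /=; rewrite coefC ?coef0 ?eqxx//.
  move=> pa; rewrite addn1 /=; have : (a < size p)%N.
    by rewrite ltnNge; apply: contra pa => pa; rewrite nth_default.
  by move: sp sC ltN; set x := size p; set y := size C; nia.
have iB : poly_integral h B = poly_integral f B.
  by apply: (agree_poly_integral Wh Wf hf) => //; lia.
have pD0 x : 0 <= x <= 1 -> p.[1 - x] * Delta (1 - x) = 0.
  have cp : continuous (fun x : R => p.[1 - x]).
    by move=> z; apply: (continuous_comp (c1B z)); exact: continuous_horner.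
  apply: (@tail_eq0 R (fun x => p.[1 - x] * Delta (1 - x))).
  - apply: (continuous_mul cp) => z.
    by apply: (continuous_comp (c1B z)); exact: cD.
  - by move=> y y01; apply: pD; exact: refl01.
  - have dB g : in_W g ->
        density (fun y : T => unit_ind y * B.[(ones g y)%:P].[unit_tail y]).
      move=> Wg; apply: densityMr; first exact: density_unit_ind.
      apply: continuous_poly2; last exact: cones.
      by apply: continuous_tail; exact: density_unit_ind.
    transitivity (poly_integral h B - poly_integral f B); last by rewrite iB subrr.
    rewrite -[- _]mulN1r /poly_integral -tailZ; last exact: dB.
    rewrite -tailD; [|exact: dB|exact/densityZ/dB].
    apply: eq_tail => y; rewrite unit_indE.
    have [y01|_] := boolP (0 <= (y : R) <= 1); last by rewrite !mul0r mulr0 addr0.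
    by rewrite !mul1r /unit_tail (tail_unit_ind y01) !BE /Delta subKr mulN1r mulrBr.
have D0 : forall z, 0 <= z <= 1 -> Delta z = 0.
  apply: (continuous_eq0_cofinite cD (C := C)) => z z01 zC.
  have := pD0 (1 - z) (refl01 _ z01); rewrite subKr => /eqP.
  rewrite mulf_eq0 => /orP[pz|/eqP//].
  by move/negP : zC => []; apply: pC.
move=> x /refl01/D0; rewrite /Delta subKr => /eqP.
by rewrite subr_eq0 => /eqP.
Qed.

Definition word_list lo N : seq (seq bool) :=
  flatten [seq [seq true :: w | w <- words n] | n <- index_iota lo N.+1].

Lemma size_word_list lo N : (lo <= N.+1)%N ->
  (size (word_list lo N) + 2 ^ lo = 2 ^ N.+1)%N.
Proof.
move=> loN; rewrite /word_list size_flatten /shape -map_comp sumnE big_map.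
under eq_bigr do rewrite /= size_map size_words.
elim: N loN => [|N IH]; rewrite leq_eqVlt => /predU1P[->|loN].
- by rewrite big_geq.
- by move: loN; rewrite ltnS leqn0 => /eqP->; rewrite big_nat1.
- by rewrite big_geq.
by rewrite big_nat_recr//= addnAC IH// [RHS]expnS mul2n addnn.
Qed.

Lemma word_list_agree lo N f h :
  (forall u, u \in word_list lo N -> word_density u h = word_density u f) ->
  agree_on_words lo N h f.
Proof.
move=> hf w loN; apply: hf; apply/flattenP.
exists [seq true :: w' | w' <- words (size w)].
  by apply/mapP; exists (size w) => //; rewrite mem_index_iota ltnS.
by apply: map_f; rewrite mem_words.
Qed.

(** Since [phi] has no constant term, no monomial that involves [H] has total
    degree below [2]; this spares the short words in the case of one piece. *)
Lemma sqr_linear_support (phi : {poly R}) d a b : (0 < d)%N ->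
  (size phi <= d.+1)%N -> phi.[0] = 0 -> (0 < b)%N ->
  (('X - phi%:P) ^+ 2)`_b`_a != 0 -> (2 <= a + b <= d.+1)%N.
Proof.
move=> d0 sphi; rewrite horner_coef0 => phi0.
rewrite sqrrB coefD coefB coefXn coefMn coefMC coefX -rmorphXn/= coefC.
case: b => [//|[|[|b]]] _ /=;
  rewrite ?(mul0r, mul1r, mul0rn, add0r, addr0, subr0, oppr0, coef0, eqxx)//.
  rewrite coefN coefMn oppr_eq0 => phia.
  have a0 : (0 < a)%N by rewrite lt0n; apply: contraNneq phia => ->; rewrite phi0 mul0rn.
  have ad : (a < d.+1)%N.
    rewrite (leq_trans _ sphi)// ltnNge; apply: contraNN phia => pa.
    by rewrite nth_default// mul0rn.
  by lia.
by rewrite coef1; case: a => [|a]; rewrite ?eqxx//=.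
Qed.

Lemma word_list_bound1 d : (0 < d)%N -> (size (word_list 2 d.+1) <= 4 ^ d)%N.
Proof.
move=> d0; rewrite -(leq_add2r (2 ^ 2)) size_word_list//.
case: d d0 => // -[//|d] _; rewrite (leq_trans _ (leq_addr _ _))//.
by rewrite -[4%N]/(2 ^ 2)%N -expnM leq_pexp2l//; lia.
Qed.

(** The comparison rests on [2 ^ 3 <= 3 ^ 2]. *)
Lemma word_list_bound k d : (1 < k)%N -> (0 < d)%N ->
  (size (word_list 1 (3 * (d * k ^ 2)).-1) <= k.+1 ^ (2 * (d * k ^ 2)))%N.
Proof.
move=> k1 d0; set m := (d * k ^ 2)%N.
have m0 : (0 < m)%N by rewrite muln_gt0 d0 expn_gt0 (ltnW k1).
apply: (leq_trans (leq_addr (2 ^ 1) _)); rewrite size_word_list; last by lia.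
rewrite prednK; last by rewrite muln_gt0 m0.
rewrite (expnM 2 3) (expnM k.+1 2) leq_exp2r//.
by apply: (@leq_trans (3 ^ 2)) => //; rewrite leq_exp2r.
Qed.

End forcing.

Theorem theorem5 (R : realType) (k : nat) (I : 'I_k -> set R)
    (P : 'I_k -> {poly R}) (f : R -> R) :
  interval_partition I ->
  in_W f ->
  (forall (i : 'I_k) (x : R), I i x -> f x = (P i).[x]) ->
  finitely_forcible f /\
  exists us : seq (seq bool),
    (size us <= k.+1 ^ (2 * k ^ 2 * (1 + \max_(i < k) degree (P i))))%N /\
    forced_by us f.
Proof.
move=> partI Wf fP.
suff [us [sus fus]] : exists us : seq (seq bool),
    (size us <= k.+1 ^ (2 * k ^ 2 * (1 + \max_(i < k) degree (P i))))%N /\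
    forced_by us f.
  by split; exists us.
set d := (1 + \max_(i < k) degree (P i))%N.
have [Phi PhiP] := ones_piecewise partI Wf fP.
have sPhi i : (size (Phi i) <= d.+1)%N.
  rewrite (leq_trans (PhiP i).1)// ltnS (leq_trans (leqSpred _))//.
  by rewrite /d add1n ltnS; exact: (@leq_bigmax _ (fun j => degree (P j)) i).
have fPhi x : 0 <= x <= 1 -> exists i, ones f x = (Phi i).[1 - x].
  move=> x01; have [_ [coverI _ _]] := partI.
  have [i _ Iix] : cover [set: 'I_k] I x by rewrite coverI /= in_itv.
  by exists i; exact: (PhiP i).2.
have d0 : (0 < d)%N by [].
have bid := bidegree_le_separator sPhi.
have [k1|k1] := ltnP 1 k.
  (* Words of this length reach both the squared separator, of total degree at most
     2 (k + k d), and the sign-matching polynomial, of degree at most 2 d k ^ 2. *)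
  exists (word_list 1 (3 * (d * k ^ 2)).-1).
  split; first by rewrite -mulnA [(k ^ 2 * _)%N]mulnC; exact: word_list_bound.
  move=> h Wh /word_list_agree hf; apply: eq_ones_ae => //.
  have dk : (k * 2 <= d * k ^ 2)%N by nia.
  apply: (ones_eq_of_moments Wh Wf hf _ sPhi fPhi); first by lia.
  apply: (ones_in_pieces Wh Wf hf _ _ fPhi); first by lia.
  move=> a b b0; rewrite expr2 => /(bidegree_le_coef (bidegree_leM bid bid)).
  nia.
have kE : k = 1%N.
  by have [|i _] := fPhi 0; [rewrite lexx ler01|have := ltn_ord i; lia].
(* One piece: there are no crossings, but the number of words must be at most 4 ^ d. *)
subst k; exists (word_list 2 d.+1).
split; first by rewrite expnM; exact: word_list_bound1.
move=> h Wh /word_list_agree hf; apply: eq_ones_ae => //.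
(* z = 0 is the point x = 1, where tail integrals vanish. *)
have phi0 : (Phi ord0).[0] = 0.
  have [|i] := fPhi 1; first by rewrite lexx ler01.
  by rewrite subrr (ord1 i) => <-; apply: tail_ge1 => //; exact: density_letter.
have d1 : (2 <= d.+1)%N by [].
have supp a b : (0 < b)%N -> (separator Phi ^+ 2)`_b`_a != 0 ->
    (2 <= a + b <= d.+1)%N.
  by move=> b0; rewrite /separator big_ord1; exact: sqr_linear_support.
move=> x x01; have [i ->] := ones_in_pieces Wh Wf hf d1 supp fPhi x01.
by have [j ->] := fPhi _ x01; rewrite (ord1 i) (ord1 j).
Qed.
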